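(* Let $V$ be a simple weight $AW$-module such that $\dim V_{(\lambda,\mu)}<\infty$ for some $(\lambda,\mu)\in\mathrm{Supp}(V)$. Then $V\cong F(P,M)$ for some simple weight $\mathcal K_{m,n}$-module $P$ and some simple weight $\mathfrak{gl}(m,n)$-module $M$.
   Context: All over $\mathbb C$; modules are $\mathbb Z_2$-graded, simple means no nontrivial graded submodules. Fix $(m,n)\in\mathbb Z_+^2\setminus\{(0,0)\}$. $A=\mathbb C[t_1,\dots,t_m]\otimes\Lambda(\xi_1,\dots,\xi_n)$ (even $t_i$, odd $\xi_j$), monomials $t^\alpha\xi_I$ ($\xi_I$ = product of $\xi_l$, $l\in I$ in increasing order). $W$ = Lie superalgebra of superderivations of $A$, $\tilde W=W\ltimes A$ with $[x,a]=x(a)$. $H=\mathrm{span}\{d_i=t_i\partial_{t_i},\delta_j=\xi_j\partial_{\xi_j}\}$. A weight module is one with $M=\bigoplus_{(\lambda,\mu)\in\mathbb C^{m+n}}M_{(\lambda,\mu)}$, $M_{(\lambda,\mu)}=\{v:d_iv=\lambda_iv,\delta_jv=\mu_jv\}$, and $\mathrm{Supp}(M)=\{(\lambda,\mu):M_{(\lambda,\mu)}\ne0\}$. An $AW$-module is a $\tilde W$-module on which $A$ acts associatively with $1$ acting as identity. $\mathcal K_{m,n}$ is the Weyl superalgebra generated by $t_i,\xi_j,\partial_{t_i},\partial_{\xi_j}$ (weight modules: $t_i\partial_{t_i},\xi_j\partial_{\xi_j}$ act diagonalizably). $\mathfrak{gl}(m,n)$ has matrix units $E_{a,b}$ ($E_{a,b}$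 odd iff exactly one of $a,b$ exceeds $m$); weight modules: all $E_{a,a}$ act diagonalizably. For a $\mathcal K_{m,n}$-module $P$ and a $\mathfrak{gl}(m,n)$-module $M$, $F(P,M)=P\otimes M$ is the $AW$-module on which, for $\alpha\in\mathbb Z_+^m$, $I\subseteq\{1,\dots,n\}$ ($|I|$ its cardinality), $i\le m$, $j\le n$: $t^\alpha\xi_I$ acts as $t^\alpha\xi_I\otimes1$; $t^\alpha\xi_I\partial_{t_i}$ acts as $t^\alpha\xi_I\partial_{t_i}\otimes1+\sum_{k=1}^m\alpha_kt^{\alpha-e_k}\xi_I\otimes E_{k,i}+(-1)^{|I|-1}\sum_{k=1}^n\partial_{\xi_k}(t^\alpha\xi_I)\otimes E_{m+k,i}$; $t^\alpha\xi_I\partial_{\xi_j}$ acts as $t^\alpha\xi_I\partial_{\xi_j}\otimes1+\sum_{k=1}^m\alpha_kt^{\alpha-e_k}\xi_I\otimes E_{k,m+j}+(-1)^{|I|-1}\sum_{k=1}^n\partial_{\xi_k}(t^\alpha\xi_I)\otimes E_{m+k,m+j}$; where $(x\otimes y)(u\otimes v)=(-1)^{|y||u|}xu\otimes yv$. *)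

(* Defs.v *)
From HB Require Import structures.
From mathcomp Require Import all_boot all_algebra.
From mathcomp Require Import complex Rstruct.

Set Implicit Arguments.
Unset Strict Implicit.
Unset Printing Implicit Defensive.

Import GRing.Theory.
Local Open Scope ring_scope.

Definition C : numClosedFieldType := (Rdefinitions.R)[i].

Definition sg (b : bool) : C := (-1) ^+ b.

Definition subspace (V : lmodType C) (S : V -> Prop) : Prop :=
  S 0 /\ (forall u v, S u -> S v -> S (u + v)) /\ (forall (c : C) v, S v -> S (c *: v)).

Definition lin (V : lmodType C) (f : V -> V) : Prop :=
  forall (c : C) u v, f (c *: u + v) = c *: f u + f v.

(* A Z_2-grading V = V_0 (+) V_1 ; G b is the subspace V_b (b = false: even). *)
Definition grading (V : lmodType C) (G : bool -> V -> Prop) : Prop :=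
  (forall b, subspace (G b)) /\
  (forall v, exists v0 v1, G false v0 /\ G true v1 /\ v = v0 + v1) /\
  (forall v, G false v -> G true v -> v = 0).

Definition has_parity (V : lmodType C) (G : bool -> V -> Prop) (f : V -> V) (p : bool) :=
  forall b v, G b v -> G (b (+) p) (f v).

Definition scomm (V : lmodType C) (f g : V -> V) (pf pg : bool) : V -> V :=
  fun v => f (g v) - sg (pf && pg) *: g (f v).

Definition gsimple (V : lmodType C) (G : bool -> V -> Prop) (I : Type) (ops : I -> V -> V) :=
  (exists v : V, v <> 0) /\
  forall S : V -> Prop, subspace S ->
    (forall v, S v -> exists v0 v1, S v0 /\ S v1 /\ G false v0 /\ G true v1 /\ v = v0 + v1) ->
    (forall i v, S v -> S (ops i v)) ->
    (forall v, S v -> v = 0) \/ (forall v, S v).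

Definition wspace (V : lmodType C) (J : Type) (h : J -> V -> V) (w : J -> C) (v : V) : Prop :=
  forall j, h j v = w j *: v.

Definition weight_mod (V : lmodType C) (J : Type) (h : J -> V -> V) : Prop :=
  forall v : V, exists (k : nat) (vs : 'I_k -> V) (ws : 'I_k -> J -> C),
    (forall i, wspace h (ws i) (vs i)) /\ v = \sum_(i < k) vs i.

Definition fin_dim (V : lmodType C) (S : V -> Prop) : Prop :=
  exists s : seq V, forall v, S v ->
    exists c : 'I_(size s) -> C, v = \sum_(i < size s) c i *: s`_i.

Definition lin2 (P M V : lmodType C) (b : P -> M -> V) : Prop :=
  (forall (c : C) u u' v, b (c *: u + u') v = c *: b u v + b u' v) /\
  (forall (c : C) u v v', b u (c *: v + v') = c *: b u v + b u v').

Definition is_tensor (P M V : lmodType C) (b : P -> M -> V) : Prop :=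
  lin2 b /\
  forall (Z : lmodType C) (g : P -> M -> Z), lin2 g ->
    (exists h : V -> Z, (forall (c : C) x y, h (c *: x + y) = c *: h x + h y) /\
                        forall u v, h (b u v) = g u v) /\
    (forall h1 h2 : V -> Z,
       (forall (c : C) x y, h1 (c *: x + y) = c *: h1 x + h1 y) ->
       (forall (c : C) x y, h2 (c *: x + y) = c *: h2 x + h2 y) ->
       (forall u v, h1 (b u v) = g u v) -> (forall u v, h2 (b u v) = g u v) ->
       forall x, h1 x = h2 x).

(* The superalgebra A = C[t_1..t_m] (x) Lambda(xi_1..xi_n) and W = Der A,
   described through their monomial bases.                                   *)

Section Mon.
Variables m n : nat.

(* monomial t^alpha xi_I *)
Definition mono := (('I_m -> nat) * {set 'I_n})%type.
(* index of a variable / of a partial derivative: inl i = t_i, inr j = xi_j;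
   also the index set {1..m+n} of gl(m,n) (inl i = i, inr j = m+j) *)
Definition idx := ('I_m + 'I_n)%type.

Definition ipar (k : idx) : bool := if k is inr _ then true else false.
Definition mpar (x : mono) : bool := odd #|x.2|.
(* parity of the derivation t^alpha xi_I d_k *)
Definition dpar (x : mono) (k : idx) : bool := mpar x (+) ipar k.

Definition mono1 : mono := (fun _ => 0%N, set0).

(* number of pairs (i,j) in I x J with j < i : sign of reordering xi_I xi_J *)
Definition ninv (I J : {set 'I_n}) : nat :=
  #|[set p : 'I_n * 'I_n | (p.1 \in I) && (p.2 \in J) && (p.2 < p.1)%N]|.

(* product of monomials: (t^a xi_I)(t^b xi_J) = c * t^(a+b) xi_(I u J) *)
Definition mono_mul (x y : mono) : C * mono :=
  (if [disjoint x.2 & y.2] then sg (odd (ninv x.2 y.2)) else 0,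
   (fun i => (x.1 i + y.1 i)%N, x.2 :|: y.2)).

Definition mono_der (k : idx) (y : mono) : C * mono :=
  match k with
  | inl i => ((y.1 i)%:R, (fun l => (y.1 l - (l == i))%N, y.2))
  | inr j => if j \in y.2 then (sg (odd #|[set l in y.2 | (l < j)%N]|), (y.1, y.2 :\ j))
             else (0, y)
  end.

Definition der_app (x : mono) (k : idx) (y : mono) : C * mono :=
  let cz := mono_der k y in
  let pw := mono_mul x cz.2 in (cz.1 * pw.1, pw.2).

Definition ei (i : 'I_m) : 'I_m -> nat := fun l => (l == i)%N.
Definition dW (i : 'I_m) : mono * idx := ((ei i, set0), inl i).
Definition deltaW (j : 'I_n) : mono * idx := ((fun _ => 0%N, [set j]), inr j).

(* An AW-module structure on V (over the basis {t^a xi_I} of A and the basis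
   {t^a xi_I d_k} of W), graded by G.  aA x = action of x in A, aW x k = action
   of x d_k in W.  The conditions say: the actions are linear and of the right
   parity, A acts associatively with 1 acting as identity, and the action of
   W~ = W |x A respects the super brackets
     [x d_k, y d_l] = x d_k(y) d_l - (-1)^{|X||Y|} y d_l(x) d_k,
     [x d_k, a] = x d_k(a),  [a, b] = 0. *)
Definition AWmodule (V : lmodType C) (G : bool -> V -> Prop)
    (aA : mono -> V -> V) (aW : mono -> idx -> V -> V) : Prop :=
  grading G /\
  (forall x, lin (aA x)) /\ (forall x k, lin (aW x k)) /\
  (forall x, has_parity G (aA x) (mpar x)) /\
  (forall x k, has_parity G (aW x k) (dpar x k)) /\
  (forall v, aA mono1 v = v) /\
  (forall x y v, aA x (aA y v) = (mono_mul x y).1 *: aA (mono_mul x y).2 v) /\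
  (forall x y v, scomm (aA x) (aA y) (mpar x) (mpar y) v = 0) /\
  (forall x k y l v,
     scomm (aW x k) (aW y l) (dpar x k) (dpar y l) v =
       (der_app x k y).1 *: aW (der_app x k y).2 l v
       - sg (dpar x k && dpar y l) * (der_app y l x).1 *: aW (der_app y l x).2 k v) /\
  (forall x k y v,
     scomm (aW x k) (aA y) (dpar x k) (mpar y) v = (der_app x k y).1 *: aA (der_app x k y).2 v).

Definition AWops (V : lmodType C) (aA : mono -> V -> V) (aW : mono -> idx -> V -> V)
    (o : mono + (mono * idx)) : V -> V :=
  match o with inl x => aA x | inr xk => aW xk.1 xk.2 end.

(* the Cartan operators d_i = t_i d_{t_i}, delta_j = xi_j d_{xi_j} *)
Definition AWh (V : lmodType C) (aW : mono -> idx -> V -> V) (k : idx) : V -> V :=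
  match k with inl i => aW (dW i).1 (dW i).2 | inr j => aW (deltaW j).1 (deltaW j).2 end.

(* Modules over the Weyl superalgebra K_{m,n}: generators (k, false) = t_i / xi_j,
   (k, true) = d_{t_i} / d_{xi_j}, with the defining super-commutation relations
   [x_a, x_b] = 0, [d_a, d_b] = 0, [d_a, x_b] = delta_{ab}.                    *)
Definition Kgen := (idx * bool)%type.

Definition Kmodule (P : lmodType C) (G : bool -> P -> Prop) (K : Kgen -> P -> P) : Prop :=
  grading G /\ (forall g, lin (K g)) /\
  (forall g, has_parity G (K g) (ipar g.1)) /\
  (forall a b v, scomm (K (a, false)) (K (b, false)) (ipar a) (ipar b) v = 0) /\
  (forall a b v, scomm (K (a, true)) (K (b, true)) (ipar a) (ipar b) v = 0) /\
  (forall a b v, scomm (K (a, true)) (K (b, false)) (ipar a) (ipar b) v =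
                   if a == b then v else 0).

Definition Kh (P : lmodType C) (K : Kgen -> P -> P) (k : idx) : P -> P :=
  fun v => K (k, false) (K (k, true) v).

(* the operator t^alpha xi_I on P (xi's in increasing order) *)
Definition Kmono (P : lmodType C) (K : Kgen -> P -> P) (x : mono) : P -> P :=
  fun v => foldr (fun i u => iter (x.1 i) (K (inl i, false)) u)
                 (foldr (fun j u => K (inr j, false) u) v (enum x.2))
                 (enum 'I_m).

Definition glpar (a b : idx) : bool := ipar a (+) ipar b.

Definition glmodule (M : lmodType C) (G : bool -> M -> Prop) (E : idx -> idx -> M -> M) : Prop :=
  grading G /\ (forall a b, lin (E a b)) /\
  (forall a b, has_parity G (E a b) (glpar a b)) /\
  (forall a b c d v, scomm (E a b) (E c d) (glpar a b) (glpar c d) v =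
     (if b == c then E a d v else 0)
     - sg (glpar a b && glpar c d) *: (if d == a then E c b v else 0)).

Definition glops (M : lmodType C) (E : idx -> idx -> M -> M) (ab : idx * idx) : M -> M :=
  E ab.1 ab.2.
Definition glh (M : lmodType C) (E : idx -> idx -> M -> M) (a : idx) : M -> M := E a a.

(* "V with the AW-action (aA, aW) is isomorphic to F(P,M)": b : P x M -> V makes
   V a (graded) tensor product P (x) M, and on pure tensors u (x) v with u
   homogeneous of parity pu the action is given by the formulas of F(P,M). *)
Definition is_FPM (V : lmodType C) (G : bool -> V -> Prop)
    (aA : mono -> V -> V) (aW : mono -> idx -> V -> V)
    (P : lmodType C) (GP : bool -> P -> Prop) (K : Kgen -> P -> P)
    (M : lmodType C) (GM : bool -> M -> Prop) (E : idx -> idx -> M -> M)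
    (b : P -> M -> V) : Prop :=
  is_tensor b /\
  (forall p q u v, GP p u -> GM q v -> G (p (+) q) (b u v)) /\
  (forall x u v, aA x (b u v) = b (Kmono K x u) v) /\
  (forall x l pu u v, GP pu u ->
     aW x l (b u v) =
       b (Kmono K x (K (l, true) u)) v
       + \sum_(k < m) ((x.1 k)%:R * sg (pu && ipar l)) *:
             b (Kmono K (fun i => (x.1 i - (i == k))%N, x.2) u) (E (inl k) l v)
       + sg (~~ odd #|x.2|) *:
         \sum_(k < n) ((mono_der (inr k) x).1 * sg (pu && ~~ ipar l)) *:
             b (Kmono K (mono_der (inr k) x).2 u) (E (inr k) l v)).

End Mon.

(* Main.v *)
Require Import Defs.
From HB Require Import structures.
From mathcomp Require Import all_boot all_algebra.
From mathcomp Require Import complex Rstruct.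
From mathcomp Require Import boolp ring.

(** Write X_k for the action of the variable x_k, D_k for that of d_k, and let
    E_ab be the action of x_a d_b minus X_a D_b.  The X_k, D_k define an action
    of the Weyl superalgebra K on V, the E_ab satisfy the relations of gl(m,n),
    and the two families supercommute.

    In the finite-dimensional weight space the commuting operators X_k D_k have a
    common eigenvector v0, which is therefore an eigenvector of Eu = sum_k E_kk,
    for a value c.  The action of x d_l raises Eu-eigenvalues by natural numbers
    only, so the generalized eigenspaces for c + 1, c + 2, ... form a proper, hence
    zero, submodule; it follows that Eu = c on V.  Then [Eu, x d_l] = 0 expresses
    the action of x d_l through monomials of smaller degree, and induction on the
    degree of x yields the formula of F(P,M) in terms of X, D and E.

    So V is simple for K and gl(m,n) jointly.  Let M be the weight space of v0 for
    the operators X_k D_k and P = K v0.  Words of degree zero in the X_k, D_k act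
    on each weight space by scalars, so by simplicity a word either kills M or is
    invertible on it, and words of equal degree are proportional on M.  Hence
    k v0 (x) w |-> k w is a well-defined isomorphism from P (x) M onto V. *)

Set Implicit Arguments.
Unset Strict Implicit.
Unset Printing Implicit Defensive.

Import GRing.Theory Num.Theory.
Local Open Scope ring_scope.

(** * Linear identities by reflection *)

Inductive lexp :=
  LAtom of nat | LZero | LAdd of lexp & lexp | LOpp of lexp | LScale of C & lexp.

Fixpoint leval (V : lmodType C) (env : seq V) (e : lexp) : V :=
  match e with
  | LAtom i => nth 0 env i
  | LZero => 0
  | LAdd e1 e2 => leval env e1 + leval env e2
  | LOpp e1 => - leval env e1
  | LScale c e1 => c *: leval env e1
  end.

(** Indices are compared with [Nat.eqb], which [lmod] evaluates by computation to leave plain scalar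
    expressions. *)
Fixpoint lcoef (i : nat) (e : lexp) : C :=
  match e with
  | LAtom k => if Nat.eqb i k then 1 else 0
  | LZero => 0
  | LAdd e1 e2 => lcoef i e1 + lcoef i e2
  | LOpp e1 => - lcoef i e1
  | LScale c e1 => c * lcoef i e1
  end.

Fixpoint lagree (k : nat) (e1 e2 : lexp) : Prop :=
  if k is k'.+1 then lcoef k' e1 = lcoef k' e2 /\ lagree k' e1 e2 else True.

Lemma levalE (V : lmodType C) (env : seq V) e :
  leval env e = \sum_(i < size env) lcoef i e *: env`_i.
Proof.
elim: e => [k||e1 IH1 e2 IH2|e1 IH1|c e1 IH1] /=.
- have eqbE i : Nat.eqb i k = (i == k) by [].
  case: (ltnP k (size env)) => hk; last first.
    rewrite nth_default // big1 // => i _; rewrite eqbE.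
    by rewrite (ltn_eqF (leq_trans (ltn_ord i) hk)) scale0r.
  rewrite (bigD1 (Ordinal hk)) //= eqbE eqxx scale1r big1 ?addr0 // => i ni.
  by rewrite eqbE; case: eqP => [ik|_]; rewrite ?scale0r //; case/eqP: ni; apply/val_inj.
- by rewrite big1 // => i _; rewrite scale0r.
- by rewrite IH1 IH2 -big_split; apply: eq_bigr => i _; rewrite scalerDl.
- by rewrite IH1 -sumrN; apply: eq_bigr => i _; rewrite scaleNr.
- by rewrite IH1 scaler_sumr; apply: eq_bigr => i _; rewrite scalerA.
Qed.

(** Atoms are treated as independent, so agreement of coefficients suffices; [lmod] leaves these
    scalar identities to [ring]. *)
Lemma leval_eq (V : lmodType C) (env : seq V) e1 e2 :
  lagree (size env) e1 e2 -> leval env e1 = leval env e2.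
Proof.
move=> h; rewrite !levalE; apply: eq_bigr => i _; congr (_ *: _).
elim: (size env) h (nat_of_ord i) (ltn_ord i) => //= k IH [hk hr] j.
by rewrite ltnS leq_eqVlt => /orP[/eqP->//|/IH]; apply.
Qed.

Ltac lmod_add x env :=
  let rec go l :=
    lazymatch l with
    | nil => constr:(x :: env)
    | x :: _ => env
    | _ :: ?l' => go l'
    end in go env.
Ltac lmod_index x env :=
  lazymatch env with
  | x :: _ => constr:(0%N)
  | _ :: ?l => let i := lmod_index x l in constr:(S i)
  end.
Ltac lmod_atoms t env :=
  lazymatch t with
  | GRing.zero => env
  | ?a + ?b => let e := lmod_atoms a env in lmod_atoms b e
  | - ?a => lmod_atoms a env
  | _ *: ?a => lmod_atoms a env
  | _ => lmod_add t env
  end.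
Ltac lmod_reify t env :=
  lazymatch t with
  | GRing.zero => constr:(LZero)
  | ?a + ?b => let x := lmod_reify a env in let y := lmod_reify b env in
               constr:(LAdd x y)
  | - ?a => let x := lmod_reify a env in constr:(LOpp x)
  | ?c *: ?a => let x := lmod_reify a env in constr:(LScale c x)
  | _ => let i := lmod_index t env in constr:(LAtom i)
  end.
Ltac lmod :=
  lazymatch goal with
  | |- @eq ?T ?a ?b =>
    let env := lmod_atoms a (@nil T) in
    let env := lmod_atoms b env in
    let x := lmod_reify a env in
    let y := lmod_reify b env in
    refine (@leval_eq _ env x y _);
    cbn [lagree lcoef size Nat.eqb]; repeat split; ring
  end.

(** * Signs and linear operators *)

Lemma sgK b : sg b * sg b = 1.
Proof. by case: b; rewrite /sg ?expr1 ?expr0 ?mulrNN mulr1. Qed.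

Lemma sgT : sg true = -1. Proof. by rewrite /sg expr1. Qed.
Lemma sgF : sg false = 1. Proof. by rewrite /sg expr0. Qed.

Lemma sgD a b : sg (a (+) b) = sg a * sg b.
Proof. by rewrite /sg signr_addb. Qed.

Lemma sgM b (V : lmodType C) (v : V) : sg b *: (sg b *: v) = v.
Proof. by rewrite scalerA sgK scale1r. Qed.

Section Lin.
Variables (V : lmodType C).
Implicit Types (f : V -> V).

Lemma linD f u v : lin f -> f (u + v) = f u + f v.
Proof. by move=> hf; rewrite -[u]scale1r hf !scale1r. Qed.
Lemma lin0 f : lin f -> f 0 = 0.
Proof. by move=> hf; have := hf (-1) 0 0; rewrite scaler0 addr0 scaleN1r addNr; exact. Qed.
Lemma linZ f c v : lin f -> f (c *: v) = c *: f v.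
Proof. by move=> hf; rewrite -[c *: v]addr0 hf lin0 // addr0. Qed.
Lemma linN f v : lin f -> f (- v) = - f v.
Proof. by move=> hf; rewrite -scaleN1r linZ // scaleN1r. Qed.
Lemma linB f u v : lin f -> f (u - v) = f u - f v.
Proof. by move=> hf; rewrite linD // linN. Qed.
Lemma lin_sum f (I : Type) (s : seq I) (P : pred I) (F : I -> V) :
  lin f -> f (\sum_(i <- s | P i) F i) = \sum_(i <- s | P i) f (F i).
Proof.
move=> hf; elim: s => [|i s IH]; rewrite ?big_nil ?lin0 //.
by rewrite !big_cons; case: ifP => _; rewrite ?linD // IH.
Qed.

Lemma subspaceN (S : V -> Prop) v : subspace S -> S v -> S (- v).
Proof. by move=> [_ [_ hZ]] hv; rewrite -scaleN1r; apply: hZ. Qed.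
Lemma subspaceB (S : V -> Prop) u v : subspace S -> S u -> S v -> S (u - v).
Proof. by move=> sS hu hv; case: (sS) => _ [hD _]; apply: hD => //; apply: subspaceN. Qed.
Lemma subspace_sum (S : V -> Prop) (I : Type) (s : seq I) (P : pred I) (F : I -> V) :
  subspace S -> (forall i, P i -> S (F i)) -> S (\sum_(i <- s | P i) F i).
Proof. by move=> [h0 [hD _]] hF; elim/big_ind: _. Qed.

End Lin.

(** * Subspaces, gradings and weights *)

Section SubLmod.
Variables (V : lmodType C) (S : V -> Prop).

(** The classical truth value of [S] as a boolean predicate, from which the subspace receives a
    module structure of its own. *)
Definition sub_pred (hS : subspace S) : {pred V} := fun v => `[< S v >].

Variable hS : subspace S.

Lemma sub_predP v : reflect (S v) (v \in sub_pred hS).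
Proof. exact: asboolP. Qed.

Lemma sub_pred_closed : submod_closed (sub_pred hS).
Proof.
case: (hS) => h0 [hD hZ]; split; first exact/sub_predP.
by move=> c u v /sub_predP hu /sub_predP hv; apply/sub_predP/hD => //; apply: hZ.
Qed.

HB.instance Definition _ := GRing.isSubmodClosed.Build C V (sub_pred hS) sub_pred_closed.

Record sub_lmod := SubLmod { sub_val : V; _ : sub_val \in sub_pred hS }.

HB.instance Definition _ := [isSub for sub_val].
HB.instance Definition _ := [Choice of sub_lmod by <:].
HB.instance Definition _ := [SubChoice_isSubLmodule of sub_lmod by <:].

(** Vectors outside [S] are sent to 0, so the value is meaningful on [S] only. *)
Definition sub_mk (v : V) : sub_lmod := insubd (0 : sub_lmod) v.

Lemma sub_valP (u : sub_lmod) : S (val u).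
Proof. exact/(sub_predP _)/valP. Qed.

Lemma sub_mkK v : S v -> val (sub_mk v) = v.
Proof. by move=> hv; rewrite /sub_mk val_insubd; move/sub_predP: hv => ->. Qed.

Lemma sub_val_lin c (u v : sub_lmod) : val (c *: u + v) = c *: val u + val v.
Proof. by rewrite linearP. Qed.

Lemma sub_valB c (u v : sub_lmod) : val (u - c *: v) = val u - c *: val v.
Proof. by rewrite raddfB linearZ. Qed.

Lemma sub_valZ c (u : sub_lmod) : val (c *: u) = c *: val u.
Proof. by rewrite linearZ. Qed.

Definition sub_op (f : V -> V) (u : sub_lmod) : sub_lmod := sub_mk (f (val u)).

Lemma sub_opE f u : (forall v, S v -> S (f v)) -> val (sub_op f u) = f (val u).
Proof. by move=> hf; rewrite sub_mkK //; apply/hf/sub_valP. Qed.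

Lemma sub_op_lin f : lin f -> (forall v, S v -> S (f v)) -> lin (sub_op f).
Proof.
move=> lf hf c u v; apply: val_inj.
by rewrite sub_val_lin !sub_opE // sub_val_lin lf.
Qed.

Lemma sub_image_subspace (T : sub_lmod -> Prop) :
  subspace T -> subspace (fun v => exists2 u, T u & val u = v).
Proof.
move=> [h0 [hD hZ]]; split; first by exists 0 => //; rewrite raddf0.
split=> [_ _ [u hu <-] [v hv <-]|c _ [u hu <-]].
- by exists (u + v); [apply: hD | rewrite raddfD].
- by exists (c *: u); [apply: hZ | rewrite linearZ].
Qed.

End SubLmod.

Section Graded.
Variables (V : lmodType C) (G : bool -> V -> Prop).
Hypothesis gG : grading G.

Definition gstable (S : V -> Prop) :=
  forall v, S v -> exists v0 v1, S v0 /\ S v1 /\ G false v0 /\ G true v1 /\ v = v0 + v1.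

(** The vector [a - u = v - b] is both even and odd. *)
Lemma grading_uniq a b u v : a + b = u + v ->
  G false a -> G true b -> G false u -> G true v -> a = u /\ b = v.
Proof.
case: gG => [sG [_ h0]] e ha hb hu hv.
have e' : a - u = v - b.
  by apply/eqP; rewrite subr_eq addrAC eq_sym subr_eq eq_sym addrC e addrC.
have z : a - u = 0.
  by apply: h0; last rewrite e'; apply: subspaceB.
split; first by apply/eqP; rewrite -subr_eq0 z.
by apply/esym/eqP; rewrite -subr_eq0 -e' z.
Qed.

Lemma grading_cap b v : G b v -> G (~~ b) v -> v = 0.
Proof. by case: gG => _ [_ h0]; case: b => h1 h2; apply: h0. Qed.

(** The images of the two homogeneous components have opposite parities and sum to 0, so both
    vanish. *)
Lemma kernel_gstable (f : V -> V) p :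
  lin f -> has_parity G f p -> gstable (fun v => f v = 0).
Proof.
move=> lf pf v fv; case: (gG) => sG [hd h0]; have [v0 [v1 [h1 [h2 e]]]] := hd v.
exists v0, v1; move: fv; rewrite e linD // => fv.
have e' : f v0 = - f v1 by apply/eqP; rewrite -addr_eq0 fv.
have q0 := pf _ _ h1; have q1 := pf _ _ h2.
have z0 : f v0 = 0.
  apply: (grading_cap q0); rewrite e' -addTb addbA addTb.
  by apply: subspaceN => //; move: q1; case: (p).
by move: fv; rewrite z0 add0r => ->.
Qed.

Lemma gstable_and (S : V -> Prop) (T : V -> Prop) :
  gstable S -> gstable T -> gstable (fun v => S v /\ T v).
Proof.
move=> gS gT v [/gS [a [b [Sa [Sb [Ga [Gb e]]]]]] /gT [c [d [Tc [Td [Gc [Gd e']]]]]]].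
have [eac ebd] : a = c /\ b = d by apply: grading_uniq => //; rewrite -e.
by exists a, b; rewrite -eac in Tc; rewrite -ebd in Td.
Qed.

(** Uniqueness of homogeneous components makes the decompositions supplied by the individual [T j]
    coincide. *)
Lemma gstable_forall (J : Type) (T : J -> V -> Prop) :
  (forall j, gstable (T j)) -> gstable (fun v => forall j, T j v).
Proof.
move=> gT v hv; case: (gG) => _ [hd _]; have [v0 [v1 [h1 [h2 e]]]] := hd v.
have T01 j : T j v0 /\ T j v1.
  have [a [b [Sa [Sb [Ga [Gb e']]]]]] := gT j v (hv j).
  by have [-> ->] : v0 = a /\ v1 = b by apply: grading_uniq => //; rewrite -e.
by exists v0, v1; split=> [j|]; [case: (T01 j)|split=> [j|]; [case: (T01 j)|]].
Qed.

Lemma gstable_homog (S : V -> Prop) :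
  gstable S -> (exists2 v, S v & v <> 0) -> exists b v, [/\ S v, G b v & v <> 0].
Proof.
move=> gS [v Sv nv]; have [a [b [Sa [Sb [Ga [Gb e]]]]]] := gS v Sv.
have [a0|na] := pselect (a = 0); last by exists false, a.
by exists true, b; split=> // b0; apply: nv; rewrite e a0 b0 addr0.
Qed.

Lemma eigen_lin (f : V -> V) c : lin f -> lin (fun v => f v - c *: v).
Proof. by move=> lf d u v; rewrite lf; lmod. Qed.

Lemma eigen_gstable (f : V -> V) c :
  lin f -> has_parity G f false -> gstable (fun v => f v = c *: v).
Proof.
move=> lf pf v fv.
have lg := eigen_lin c lf.
have pg : has_parity G (fun v => f v - c *: v) false.
  move=> b u hu; case: (gG) => /(_ (b (+) false)) sG _; case: (sG) => _ [hD hZ].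
  by apply: subspaceB; [|exact: pf | apply: hZ; rewrite addbF].
have [|a [b [ha [hb [h1 [h2 e]]]]]] := kernel_gstable lg pg (v := v).
  by rewrite fv subrr.
by exists a, b; split; [|split=> //]; apply/eqP; rewrite -subr_eq0 ?ha ?hb.
Qed.

Lemma sub_grading (S : V -> Prop) (hS : subspace S) q : gstable S ->
  grading (fun b (u : sub_lmod hS) => G (b (+) q) (val u)).
Proof.
move=> gS; case: (gG) => sG [_ h0]; split=> [b|]; last split.
- case: (sG (b (+) q)) => s0 [sD sZ]; split; first by rewrite raddf0.
  split=> [u v hu hv|c v hv]; first by rewrite raddfD; apply: sD.
  by rewrite linearZ; apply: sZ.
- move=> u; have [a [b [Sa [Sb [Ga [Gb e]]]]]] := gS _ (sub_valP u).
  case: q; last first.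
    exists (sub_mk hS a), (sub_mk hS b); rewrite !sub_mkK //; do 2!split=> //; apply: val_inj.
    by rewrite raddfD /= !sub_mkK.
  exists (sub_mk hS b), (sub_mk hS a); rewrite !sub_mkK //; do 2!split=> //; apply: val_inj.
  by rewrite raddfD /= !sub_mkK // addrC.
- move=> u h1 h2; apply: val_inj; rewrite raddf0.
  by apply: (grading_cap h1); move: h2; case: (q).
Qed.

End Graded.

(** * Linear combinations and extension of maps from a spanning family *)

Section Extension.
Variables (U Z : lmodType C) (I : Type) (f : I -> U) (g : I -> Z).

(** A formal combination is a list of coefficient-index pairs, repetitions allowed, so that no basis
    has to be chosen. *)
Definition lcomb (W : lmodType C) (h : I -> W) (s : seq (C * I)) : W :=
  \sum_(x <- s) x.1 *: h x.2.

Lemma lcomb_cat (W : lmodType C) (h : I -> W) s t :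
  lcomb h (s ++ t) = lcomb h s + lcomb h t.
Proof. exact: big_cat. Qed.

Lemma lcomb_scale (W : lmodType C) (h : I -> W) c s :
  lcomb h [seq (c * x.1, x.2) | x <- s] = c *: lcomb h s.
Proof.
by rewrite /lcomb big_map scaler_sumr; apply: eq_bigr => x _ /=; rewrite scalerA.
Qed.

Lemma lcomb_subspace (W : lmodType C) (h : I -> W) :
  subspace (fun u => exists s, u = lcomb h s).
Proof.
split; first by exists [::]; rewrite /lcomb big_nil.
split=> [_ _ [s ->] [t ->]|c _ [s ->]]; first by exists (s ++ t); rewrite lcomb_cat.
by exists [seq (c * x.1, x.2) | x <- s]; rewrite lcomb_scale.
Qed.

Hypothesis hfg : forall s, lcomb f s = 0 -> lcomb g s = 0.

(** By [hfg] the value is independent of the expression chosen. Off the span of [f] the map is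
    arbitrary, so its linearity can be used on the span only. *)
Lemma lcomb_extension : exists h : U -> Z, forall s, h (lcomb f s) = lcomb g s.
Proof.
have hex (u : U) : exists z, forall s, u = lcomb f s -> z = lcomb g s.
  have [[s es]|n] := pselect (exists s, u = lcomb f s); last first.
    by exists 0 => s es; case: n; exists s.
  exists (lcomb g s) => t et; apply/eqP; rewrite -subr_eq0 -scaleN1r; apply/eqP.
  rewrite -lcomb_scale -lcomb_cat; apply: hfg.
  by rewrite lcomb_cat lcomb_scale -es -et scaleN1r subrr.
by have [h hh] := choice hex; exists h => s; apply/hh.
Qed.

End Extension.

(** * Eigenvectors in finite-dimensional subspaces *)

Section Eigenvector.
Variables (V : lmodType C) (f : V -> V).
Hypothesis lf : lin f.

Definition pact (p : {poly C}) (v : V) : V := \sum_(i < size p) p`_i *: iter i f v.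

Lemma pact_wide k (p : {poly C}) v : (size p <= k)%N ->
  pact p v = \sum_(i < k) p`_i *: iter i f v.
Proof.
move=> h; rewrite /pact (big_ord_widen _ (fun i => p`_i *: iter i f v) h).
rewrite big_mkcond; apply: eq_bigr => i _; case: ltnP => // hi.
by rewrite nth_default // scale0r.
Qed.

Lemma iter_lin i : lin (iter i f).
Proof. by elim: i => [|i IH] c u v //=; rewrite IH lf. Qed.

Lemma pactMX (q : {poly C}) z v : pact (q * ('X - z%:P)) v = pact q (f v - z *: v).
Proof.
have hs : (size (q * ('X - z%:P))%R <= (size q).+1)%N.
  by apply: leq_trans (size_polyMleq _ _) _; rewrite size_XsubC addn2.
rewrite (pact_wide _ hs) (@pact_wide (size q).+1 q) //.
under eq_bigr => i _ do rewrite mulrBr coefB coefMX coefMC scalerBl.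
under [RHS]eq_bigr => i _ do
  rewrite (linB _ _ (iter_lin i)) (linZ _ _ (iter_lin i)) scalerBr scalerA -iterSr.
rewrite !sumrB; congr (_ - _).
rewrite big_ord_recl /= scale0r add0r big_ord_recr /=.
by rewrite [X in _ + X *: _]nth_default // scale0r addr0.
Qed.

(** Over the complex numbers [p] has a root [z]. Either [v] is an eigenvector for [z], or
    [f v - z *: v] is a nonzero vector annihilated by a cofactor of smaller degree. *)
Lemma annihilated_eigenvector (S : V -> Prop) (p : {poly C}) v :
  subspace S -> (forall u, S u -> S (f u)) -> S v -> v <> 0 -> p != 0 ->
  pact p v = 0 -> exists c u, [/\ S u, u <> 0 & f u = c *: u].
Proof.
move=> sS fS; have [k] := ubnP (size p); elim: k p v => // k IH p v hk Sv nv np hp.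
have [|z] := closed_rootP p _.
  (* A nonzero constant cannot annihilate [v], so [p] has positive degree. *)
  apply/negP => /size_poly1P [c nc ep]; apply: nv.
  move: hp; rewrite /pact ep size_polyC nc big_ord1 coefC /= => /eqP.
  by rewrite scaler_eq0 (negPf nc) => /eqP.
move=> /factor_theorem [q eq]; rewrite {p}eq pactMX in hk np hp.
have nq : q != 0 by apply: contraNneq np => ->; rewrite mul0r.
have [ev|nv'] := pselect (f v - z *: v = 0).
  by exists z, v; split=> //; apply/eqP; rewrite -subr_eq0 ev.
apply: (IH q (f v - z *: v)) => //.
- by move: hk; rewrite size_Mmonic ?monicXsubC // size_XsubC addn2 /= ltnS.
- by case: (sS) => _ [_ hZ]; apply: subspaceB; [|apply: fS | apply: hZ].
Qed.

(** One more iterate of [f] on [v] than there are spanning vectors gives a linear dependence, that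
    is, an annihilating polynomial. *)
Lemma fin_dim_eigenvector (S : V -> Prop) :
  subspace S -> (forall u, S u -> S (f u)) -> fin_dim S -> (exists2 v, S v & v <> 0) ->
  exists c u, [/\ S u, u <> 0 & f u = c *: u].
Proof.
move=> sS fS [s hs] [v Sv nv].
have Sf i : S (iter i f v) by elim: i => //= i; apply: fS.
have [c hc] := choice (fun i => hs _ (Sf i)).
pose A := \matrix_(i < (size s).+1, j < size s) c i j.
(* There are more rows than columns, so some nonzero row vector [r] satisfies [r A = 0]. *)
have : (0 < \rank (kermx A))%N by rewrite mxrank_ker subn_gt0 ltnS rank_leq_col.
rewrite lt0n mxrank_eq0 => /rowV0Pn [r /sub_kermxP rA nr].
apply: (@annihilated_eigenvector S (rVpoly r) v) => //.
  by apply: contraNneq nr => e; rewrite -[r]rVpolyK e raddf0.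
rewrite (@pact_wide (size s).+1) ?size_poly //.
under eq_bigr => i _ do rewrite coef_rVpoly_ord hc scaler_sumr.
rewrite exchange_big big1 //= => j _.
have := congr1 (fun B : 'rV_(size s) => B 0 j) rA; rewrite !mxE => e.
under eq_bigr => i _ do rewrite scalerA.
rewrite -scaler_suml (_ : \sum_i _ = 0) ?scale0r //.
by apply: etrans e; apply: eq_bigr => i _; rewrite mxE.
Qed.

End Eigenvector.

(** The operators are treated one after the other: each preserves the joint eigenspace [T] of its
    predecessors, by commutativity. *)
Lemma common_eigenvector (V : lmodType C) (J : finType) (h : J -> V -> V) (S : V -> Prop) :
  (forall j, lin (h j)) -> (forall i j v, h i (h j v) = h j (h i v)) ->
  subspace S -> (forall j u, S u -> S (h j u)) -> fin_dim S ->
  (exists2 v, S v & v <> 0) -> exists w v, [/\ S v, v <> 0 & wspace h w v].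
Proof.
move=> lh ch sS hS fS neS.
have [w [v [Sv nv hv]]] : exists w v, [/\ S v, v <> 0 &
    forall j, j \in enum J -> h j v = w j *: v].
  elim: (enum J) => [|j l [w [v [Sv nv hv]]]].
    by case: neS => v; exists (fun=> 0), v; split.
  pose T u := S u /\ forall i, i \in l -> h i u = w i *: u.
  case: (sS) => s0 [sD sZ].
  have sT : subspace T.
    split; first by split=> // i _; rewrite lin0 // scaler0.
    split=> [a b [Sa ha] [Sb hb]|c a [Sa ha]]; split.
    - exact: sD.
    - by move=> i il; rewrite linD // ha // hb // scalerDr.
    - exact: sZ.
    - by move=> i il; rewrite linZ // ha // !scalerA mulrC.
  have hT u : T u -> T (h j u).
    by move=> [Su hu]; split; [exact: hS|move=> i il; rewrite ch hu // linZ].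
  have fT : fin_dim T by case: fS => s hs; exists s => u [/hs].
  have [|c [u [[Su hu] nu eu]]] := fin_dim_eigenvector (lh j) sT hT fT; first by exists v.
  exists (fun i => if i \in l then w i else c), u; split=> // i.
  rewrite inE; case: ifP => [il _|_]; first exact: hu.
  by rewrite orbF => /eqP ->.
by exists w, v; split=> // j; apply: hv; rewrite mem_enum.
Qed.

(* Applying (h_j - w_j) / (w0_j - w_j) kills one summand of weight w and fixes
   u, of weight w0. *)
Lemma weight_component (V : lmodType C) (J : Type) (h : J -> V -> V) (S : V -> Prop)
    (w0 : J -> C) (u : V) (I : Type) (s : seq I) (a : pred I) (f : I -> V) (wt : I -> J -> C) :
  (forall j, lin (h j)) -> subspace S -> (forall j v, S v -> S (h j v)) ->
  wspace h w0 u -> (forall i, wspace h (wt i) (f i)) -> (forall i, a i -> wt i <> w0) ->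
  S (u + \sum_(i <- s | a i) f i) -> S u.
Proof.
move=> lh sS hS hu hf hw; elim: s f hf => [|i s IH] f hf; first by rewrite big_nil addr0.
rewrite big_cons; case: ifP => [ai|_]; last exact: IH.
move=> Su; set w := wt i.
have [j nj] : exists j, w0 j - w j != 0.
  apply: contrapT => /forallNP n; apply: (hw i ai); apply: funext => j.
  by have /negP := n j; rewrite negbK subr_eq0 => /eqP.
pose t (z : V) := (w0 j - w j)^-1 *: (h j z - w j *: z).
have tS z : S z -> S (t z).
  by case: (sS) => _ [_ sZ] Sz; apply: (sZ); apply: subspaceB; [|apply: hS|apply: sZ].
have lt : lin t by move=> c x y; rewrite /t lh; lmod.
apply: (IH (fun i => t (f i))) => [k l|].
  by rewrite /= /t hf -scalerBl scalerA (linZ _ _ (lh l)) hf; lmod.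
move: (tS _ Su); rewrite (linD _ _ lt) (linD _ _ lt) (lin_sum _ _ _ lt).
suff [-> ->] : t u = u /\ t (f i) = 0 by rewrite add0r.
by rewrite /t hu hf -scalerBl scalerA mulVf // scale1r subrr scaler0.
Qed.

(** * Monomials *)

Section Monomials.
Variables m n : nat.
Local Notation idx := (idx m n).
Local Notation mono := (mono m n).
Local Notation mono1 := (@mono1 m n).
Implicit Types (x y : mono) (i j k l : idx).

Definition mvar k : mono :=
  match k with inl i => (ei i, set0) | inr j => (fun=> 0%N, [set j]) end.

Definition mdeg k x : nat :=
  match k with inl i => x.1 i | inr j => (j \in x.2) end.

Definition tdeg x : nat := (\sum_k mdeg k x)%N.

Lemma mono_eq (a b : 'I_m -> nat) (I J : {set 'I_n}) : a =1 b -> I = J -> (a, I) = (b, J).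
Proof. by move=> /funext -> ->. Qed.

Lemma ninv0l (I : {set 'I_n}) : ninv set0 I = 0%N.
Proof. by apply/eqP; rewrite cards_eq0; apply/eqP/setP => p; rewrite !inE. Qed.

Lemma ninv0r (I : {set 'I_n}) : ninv I set0 = 0%N.
Proof. by apply/eqP; rewrite cards_eq0; apply/eqP/setP => p; rewrite !inE andbF. Qed.

Lemma ninv1l (j : 'I_n) (I : {set 'I_n}) : ninv [set j] I = #|[set l in I | (l < j)%N]|.
Proof.
have inj : injective (fun l : 'I_n => (j, l)) by move=> a b [].
rewrite -(card_imset _ inj); apply: eq_card => -[a b]; rewrite !inE /=.
apply/idP/imsetP => [/andP[/andP[/eqP-> hb] hj]|[l]].
  by exists b => //; rewrite inE hb.
by rewrite inE => /andP[hl hj] [-> ->]; rewrite eqxx hl.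
Qed.

Lemma mono_mul1l x : mono_mul mono1 x = (1, x).
Proof.
case: x => a I; rewrite /mono_mul /= disjoints_subset sub0set ninv0l sgF.
by congr pair; apply: mono_eq => [l|]; rewrite ?set0U.
Qed.

Lemma mono_mul1r x : mono_mul x mono1 = (1, x).
Proof.
case: x => a I; rewrite /mono_mul /= disjoint_sym disjoints_subset sub0set ninv0r sgF.
by congr pair; apply: mono_eq => [l|]; rewrite ?setU0 ?addn0.
Qed.

Lemma mpar_mono1 : mpar mono1 = false.
Proof. by rewrite /mpar cards0. Qed.

Lemma dpar_mono1 k : dpar mono1 k = ipar k.
Proof. by rewrite /dpar mpar_mono1. Qed.

Lemma mpar_mvar k : mpar (mvar k) = ipar k.
Proof. by case: k => [i|j]; rewrite /mpar /= ?cards0 ?cards1. Qed.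

Lemma dpar_mvar k l : dpar (mvar k) l = glpar k l.
Proof. by rewrite /dpar mpar_mvar. Qed.

Lemma mono_der1 k : (mono_der k mono1).1 = 0.
Proof. by case: k => [i|j] //=; rewrite inE. Qed.

Lemma mono_der_mvar l k : (mono_der l (mvar k)).1 = (l == k)%:R.
Proof.
case: l k => [i|j] [i'|j'] //=; rewrite ?inE //=.
case: eqP => [->|nj] /=; last by case: eqP => // -[/nj].
rewrite eqxx; suff -> : [set l in [set j'] | (l < j')%N] = set0 by rewrite cards0 sgF.
by apply/setP => l; rewrite !inE; case: eqP => // ->; rewrite ltnn.
Qed.

Lemma mono_der_mvar2 k : (mono_der k (mvar k)).2 = mono1.
Proof.
case: k => [i|j] /=; last rewrite inE eqxx /=; apply: mono_eq => [l|] //.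
- by rewrite /ei subnn.
- by apply/setP => l; rewrite !inE; case: eqP.
Qed.

Lemma der_app1 k x : der_app mono1 k x = mono_der k x.
Proof. by rewrite /der_app mono_mul1l mulr1; case: mono_der. Qed.

Lemma mono_der_eq0 k x : mdeg k x = 0%N -> (mono_der k x).1 = 0.
Proof. by case: k => [i|j] /= => [->|] //; case: (j \in x.2). Qed.

(** For an odd variable, differentiation and multiplication produce the same reordering sign, and
    the two cancel. In degree zero the coefficient is still right, but the accompanying monomial is
    not [x]. *)
Lemma der_app_mvar k x : (0 < mdeg k x)%N -> der_app (mvar k) k x = ((mdeg k x)%:R, x).
Proof.
case: x k => a I [i|j] /= h; rewrite /der_app /mono_mul /=.
  rewrite disjoints_subset sub0set ninv0l sgF mulr1.
  congr pair; apply: mono_eq => [l|]; last by rewrite set0U.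
  by rewrite /ei; case: eqP => [->|_]; rewrite ?subnKC // subn0.
move: h; case: ifP => // hj _ /=.
have -> : [disjoint [set j] & I :\ j].
  by rewrite disjoints_subset sub1set !inE eqxx.
rewrite ninv1l.
have -> : [set l in I :\ j | (l < j)%N] = [set l in I | (l < j)%N].
  apply/setP => l; rewrite !inE; by case: eqP => // ->; rewrite ltnn !andbF.
by rewrite sgK; congr pair; apply: mono_eq => [l|] //; rewrite setD1K.
Qed.

Lemma mono_der_set k x :
  (mono_der k x).2 = match k with
    | inl i => (fun p : 'I_m => (x.1 p - (p == i))%N, x.2)
    | inr j => (x.1, x.2 :\ j) end.
Proof.
case: x k => a I [i|j] //=; case: ifP => //= hj; congr pair.
by apply/setP => l; rewrite !inE; case: eqP => // ->; rewrite hj.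
Qed.

Lemma mdeg_der k l x : mdeg k (mono_der l x).2 = (mdeg k x - (k == l))%N.
Proof.
rewrite mono_der_set; case: x k l => a I [i|j] [i'|j'] //=; rewrite ?subn0 //.
have -> : (inr j == inr j' :> idx) = (j == j') by [].
by rewrite !inE; case: (j == j'); case: (_ \in _).
Qed.

Lemma tdeg_der k x : (0 < mdeg k x)%N -> tdeg x = (tdeg (mono_der k x).2).+1.
Proof.
move=> h; rewrite /tdeg (bigD1 k) //= [in RHS](bigD1 k) //= mdeg_der eqxx -addSn.
congr addn; first by rewrite subn1 prednK.
by apply: eq_bigr => l /negPf nl; rewrite mdeg_der nl subn0.
Qed.

Lemma mpar_der k x : (0 < mdeg k x)%N -> mpar (mono_der k x).2 = mpar x (+) ipar k.
Proof.
rewrite mono_der_set; case: x k => a I [i|j] /= h; rewrite /mpar /= ?addbF //.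
by rewrite (cardsD1 j I); move: h; case: (j \in I) => // _; rewrite oddD /= addbT negbK.
Qed.

Lemma tdeg0 x : tdeg x = 0%N -> x = mono1.
Proof.
move=> /eqP; rewrite sum_nat_eq0 => /forallP h; case: x h => a I h.
apply: mono_eq => [i|]; first by apply/eqP; exact: (h (inl i)).
by apply/setP => j; rewrite inE; have := h (inr j); rewrite /= eqb0 => /negPf.
Qed.

Lemma tdeg1 x : tdeg x = 1%N -> exists k, x = mvar k.
Proof.
move=> h; have [k hk] : exists k, (0 < mdeg k x)%N.
  apply: contrapT => /forallNP nk; move: h; rewrite /tdeg big1 // => k _.
  by apply/eqP; rewrite -leqn0 leqNgt; apply/negP/nk.
have := der_app_mvar hk; move: (tdeg_der hk); rewrite h => -[/esym /tdeg0 e].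
by rewrite /der_app e mono_mul1r => -[_ <-]; exists k.
Qed.

Lemma mono_der_swap2 k l x :
  (mono_der k (mono_der l x).2).2 = (mono_der l (mono_der k x).2).2.
Proof.
rewrite !mono_der_set; case: x k l => a I [i|j] [i'|j'] //=; apply: mono_eq => //.
- by move=> l; rewrite subnAC.
- by apply/setP => p; rewrite !inE andbCA.
Qed.

(** Supercommutation of partial derivatives, read off on coefficients; [mono_der_swap2] is its
    counterpart for monomials. *)
Lemma mono_der_swap1 k l x :
  (mono_der l x).1 * (mono_der k (mono_der l x).2).1 =
  sg (ipar k && ipar l) * ((mono_der k x).1 * (mono_der l (mono_der k x).2).1).
Proof.
case: x k l => a I [i|j] [i'|j'] /=; rewrite ?sgF ?mul1r.
- have [->|ni] := eqVneq i i'; first by [].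
  by rewrite subn0 subn0 mulrC.
- by case: ifP => /= _; rewrite ?mul0r ?mulr0 // mulrC.
- by case: ifP => /= _; rewrite ?mul0r ?mulr0 // mulrC.
have [->|nj] := eqVneq j j'.
  by case: ifP => hj /=; rewrite ?hj ?mul0r ?mulr0 // !inE eqxx /= mulr0 mulr0.
rewrite sgT.
case hj: (j \in I); case hj': (j' \in I); rewrite /= ?hj ?hj' ?inE ?hj ?hj' ?andbF;
  rewrite ?mul0r ?mulr0 //.
rewrite (eq_sym j') nj /=.
(* Removing [p] changes the number of elements below [q] exactly when [p < q]. As exactly one of
   [j < j'] and [j' < j] holds, the two orders differ by one sign. *)
have cD (p q : 'I_n) : p \in I -> sg (odd #|[set l in I | (l < q)%N]|) =
    sg (p < q)%N * sg (odd #|[set l in I :\ p | (l < q)%N]|).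
  move=> hp; rewrite -sgD; congr sg; rewrite (cardsD1 p) !inE hp /= oddD oddb.
  congr (_ (+) odd _); apply: eq_card => l; rewrite !inE; exact: andbA.
rewrite (cD j j' hj) (cD j' j hj').
have : (val j) != j' by [].
by rewrite neq_ltn => /orP[h|h]; rewrite h (leq_gtF (ltnW h)) sgT sgF; ring.
Qed.

(* (-1)^{|I|-1} in front of the odd derivatives in the formula of F(P,M) *)
Definition fsg x k : C := sg (ipar k && ~~ mpar x).

End Monomials.

(** * The operators E_ab on an AW-module *)

Section AWcalculus.
Variables (m n : nat) (V : lmodType C) (G : bool -> V -> Prop).
Variables (aA : mono m n -> V -> V) (aW : mono m n -> idx m n -> V -> V).
Hypothesis HAW : AWmodule G aA aW.
Local Notation idx := (idx m n).
Local Notation mono := (mono m n).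
Local Notation mono1 := (@mono1 m n).
Local Notation X k := (aA (mvar k)).
Local Notation D k := (aW mono1 k).
Implicit Types (x y : mono) (a b c d k l : idx) (v : V).

Lemma AW_grading : grading G. Proof. by case: HAW. Qed.
Lemma linA x : lin (aA x). Proof. by case: HAW => _ []. Qed.
Lemma linW x k : lin (aW x k). Proof. by case: HAW => _ [_ []]. Qed.
Lemma parA x : has_parity G (aA x) (mpar x). Proof. by case: HAW => _ [_ [_ []]]. Qed.
Lemma parW x k : has_parity G (aW x k) (dpar x k).
Proof. by case: HAW => _ [_ [_ [_ []]]]. Qed.
Lemma aA1 v : aA mono1 v = v. Proof. by case: HAW => _ [_ [_ [_ [_ []]]]]. Qed.
Lemma aAM x y v : aA x (aA y v) = (mono_mul x y).1 *: aA (mono_mul x y).2 v.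
Proof. by case: HAW => _ [_ [_ [_ [_ [_ []]]]]]. Qed.
Lemma aAC x y v : aA x (aA y v) = sg (mpar x && mpar y) *: aA y (aA x v).
Proof.
case: HAW => _ [_ [_ [_ [_ [_ [_ [h _]]]]]]].
by apply/eqP; rewrite -subr_eq0; apply/eqP; exact: h.
Qed.
Lemma aWW x k y l v : aW x k (aW y l v) = sg (dpar x k && dpar y l) *: aW y l (aW x k v)
  + ((der_app x k y).1 *: aW (der_app x k y).2 l v
     - sg (dpar x k && dpar y l) * (der_app y l x).1 *: aW (der_app y l x).2 k v).
Proof.
case: HAW => _ [_ [_ [_ [_ [_ [_ [_ [h _]]]]]]]].
by rewrite -(h x k y l v) /scomm addrC subrK.
Qed.
Lemma aWA x k y v : aW x k (aA y v) = sg (dpar x k && mpar y) *: aA y (aW x k v)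
  + (der_app x k y).1 *: aA (der_app x k y).2 v.
Proof.
case: HAW => _ [_ [_ [_ [_ [_ [_ [_ [_ h]]]]]]]].
by rewrite -(h x k y v) /scomm addrC subrK.
Qed.

Lemma der_app_at_mvar x l k : der_app x l (mvar k) =
  if l == k then (1, x) else (0, (mono_mul x (mono_der l (mvar k)).2).2).
Proof.
rewrite /der_app mono_der_mvar; case: eqP => [->|_]; last by rewrite mul0r.
by rewrite mono_der_mvar2 mono_mul1r mulr1.
Qed.

Lemma DA k y v : D k (aA y v) = sg (ipar k && mpar y) *: aA y (D k v)
  + (mono_der k y).1 *: aA (mono_der k y).2 v.
Proof. by rewrite aWA dpar_mono1 der_app1. Qed.

Lemma DX k l v : D k (X l v) = sg (ipar k && ipar l) *: X l (D k v) + (k == l)%:R *: v.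
Proof.
rewrite DA mpar_mvar mono_der_mvar; case: eqP => [->|_]; last by rewrite !scale0r.
by rewrite mono_der_mvar2 aA1.
Qed.

Lemma DW k x l v : D k (aW x l v) = sg (ipar k && dpar x l) *: aW x l (D k v)
  + (mono_der k x).1 *: aW (mono_der k x).2 l v.
Proof.
rewrite aWW dpar_mono1 der_app1 /der_app mono_der1 mul0r mulr0 scale0r subr0.
by [].
Qed.

Lemma DD k l v : D k (D l v) = sg (ipar k && ipar l) *: D l (D k v).
Proof. by rewrite DW dpar_mono1 mono_der1 scale0r addr0. Qed.

Lemma WX x l k v : aW x l (X k v) = sg (dpar x l && ipar k) *: X k (aW x l v)
  + (l == k)%:R *: aA x v.
Proof.
rewrite aWA mpar_mvar der_app_at_mvar.
by case: eqP => _ //=; rewrite !scale0r.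
Qed.

(** The derivation [x d_l] is a weight vector for the adjoint action of [x_k d_k]. *)
Lemma hW k x l v : aW (mvar k) k (aW x l v) = aW x l (aW (mvar k) k v)
  + ((mdeg k x)%:R - (k == l)%:R) *: aW x l v.
Proof.
rewrite aWW dpar_mvar /glpar addbb sgF scale1r mul1r; congr (_ + _).
rewrite scalerBl; congr (_ - _).
  have [h|h] := posnP (mdeg k x); last by rewrite der_app_mvar.
  by rewrite /der_app (mono_der_eq0 h) mul0r h !scale0r.
rewrite der_app_at_mvar eq_sym; case: eqP => [->|_] //=.
by rewrite !scale0r.
Qed.

(* The difference between x_a d_b acting as an element of W and acting through
   the Weyl superalgebra; these operators span the gl(m,n)-action. *)
Definition Eop a b v : V := aW (mvar a) b v - X a (D b v).

Lemma linE a b : lin (Eop a b).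
Proof. by move=> t u v; rewrite /Eop (linW (mvar a)) (linW mono1) linA; lmod. Qed.

Lemma parE a b : has_parity G (Eop a b) (glpar a b).
Proof.
move=> q v hv; have [sG _] := AW_grading; apply: subspaceB => //.
  by rewrite -dpar_mvar; apply: parW.
by rewrite /glpar [ipar a (+) _]addbC addbA -dpar_mono1 -mpar_mvar; apply/parA/parW.
Qed.

(** The brackets of [x_a d_b] and of [X_a D_b] with [y] are both [x_a d_b(y)], so they cancel in the
    difference. *)
Lemma EA a b y v : Eop a b (aA y v) = sg (glpar a b && mpar y) *: aA y (Eop a b v).
Proof.
rewrite /Eop aWA dpar_mvar DA (linB _ _ (linA y)) (linD _ _ (linA _)).
rewrite !(linZ _ _ (linA _)) [X a (aA y _)]aAC [X a (aA _ v)]aAM /der_app mpar_mvar /glpar /=.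
case: (ipar a); case: (ipar b); case: (mpar y); rewrite /= ?sgT ?sgF; lmod.
Qed.

(** Here too the two summands of [Eop a b] have equal brackets with [D c]: a multiple of [D b] when
    [c = a], and 0 otherwise. *)
Lemma ED a b c v : Eop a b (D c v) = sg (glpar a b && ipar c) *: D c (Eop a b v).
Proof.
rewrite /Eop (linB _ _ (linW _ _)) [D c (aW (mvar a) _ _)]DW DX dpar_mvar mono_der_mvar.
rewrite [D b (D c v)]DD (linZ _ _ (linA _)) /glpar.
case: eqP => [->|_]; rewrite ?mono_der_mvar2.
all: by case: (ipar a); case: (ipar b); case: (ipar c); rewrite /= ?sgT ?sgF; lmod.
Qed.

Lemma EE a b c d v : Eop a b (Eop c d v) = sg (glpar a b && glpar c d) *: Eop c d (Eop a b v)
  + ((if b == c then Eop a d v else 0)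
     - sg (glpar a b && glpar c d) *: (if d == a then Eop c b v else 0)).
Proof.
pose s := sg (glpar a b && glpar c d).
have EopE a' b' u : Eop a' b' u = aW (mvar a') b' u - X a' (D b' u) by [].
(* Since [Eop a b] supercommutes with [X c] and [D d], only its bracket with the action of [x_c d_d]
   contributes. *)
have e1 : Eop a b (X c (D d v)) = s *: X c (D d (Eop a b v)).
  rewrite EA ED mpar_mvar (linZ _ _ (linA _)) scalerA -sgD -andb_addr.
  by rewrite /s {2}/glpar.
rewrite [Eop c d v]EopE (linB _ _ (linE a b)) {}e1.
rewrite [Eop c d (Eop _ _ _)]EopE scalerBr [RHS]addrAC; congr (_ - _).
rewrite !EopE aWW !dpar_mvar !der_app_at_mvar DW dpar_mvar mono_der_mvar.
rewrite (linB _ _ (linW _ _)) [aW (mvar c) d (X a _)]WX dpar_mvar.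
rewrite !(linD _ _ (linA _)) !(linZ _ _ (linA _)) /s /glpar {s}.
case: (eqVneq b c) => [->|nbc]; rewrite ?mono_der_mvar2;
case: (eqVneq d a) => [->|nda]; rewrite /= /Eop;
case: (ipar a); case: (ipar c); rewrite /=; try (case: (ipar b)); try (case: (ipar d));
  rewrite /= ?sgT ?sgF; try lmod.
Qed.

Definition KV (g : Kgen m n) : V -> V := if g.2 then D g.1 else X g.1.

Lemma KV_Kmodule : Kmodule G KV.
Proof.
split; first exact: AW_grading.
split; first by move=> [k []]; [exact: linW | exact: linA].
split.
  move=> [k []] q v hv; first by rewrite -dpar_mono1; apply: parW.
  by rewrite /= -mpar_mvar; apply: parA.
split; first by move=> a b v; rewrite /scomm /KV /= aAC !mpar_mvar subrr.
split; first by move=> a b v; rewrite /scomm /KV /= DD subrr.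
move=> a b v; rewrite /scomm /KV /= DX addrAC subrr add0r.
by case: eqP; rewrite ?scale1r ?scale0r.
Qed.

Lemma EK a b g v : Eop a b (KV g v) = sg (glpar a b && ipar g.1) *: KV g (Eop a b v).
Proof. by case: g => k []; rewrite /KV /= ?ED // EA mpar_mvar. Qed.

Lemma AWh_split k v : AWh aW k v = Eop k k v + Kh KV k v.
Proof.
rewrite (_ : AWh aW k v = aW (mvar k) k v); last by case: k.
by rewrite /Eop /Kh /KV /= subrK.
Qed.

Lemma EkW k x l v : Eop k k (aW x l v) = aW x l (Eop k k v)
  + (((mdeg k x)%:R - (k == l)%:R) *: aW x l v
     - (mono_der k x).1 *: X k (aW (mono_der k x).2 l v) + (k == l)%:R *: aA x (D l v)).
Proof.
rewrite /Eop hW DW (linB _ _ (linW _ _)) WX (linD _ _ (linA _)) !(linZ _ _ (linA _)).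
rewrite [l == k]eq_sym andbC.
by case: eqP => [->|_] /=; lmod.
Qed.

Definition Eu v : V := \sum_k Eop k k v.

Lemma linEu : lin Eu.
Proof.
move=> t u v; rewrite /Eu scaler_sumr -big_split; apply: eq_bigr => k _.
exact: linE.
Qed.

Lemma parEu : has_parity G Eu false.
Proof.
move=> q v hv; have [sG _] := AW_grading; apply: subspace_sum => // k _.
by rewrite -(addbb (ipar k)); apply: parE.
Qed.

Lemma EuA y v : Eu (aA y v) = aA y (Eu v).
Proof.
rewrite /Eu (lin_sum _ _ _ (linA y)); apply: eq_bigr => k _.
by rewrite EA /glpar addbb sgF scale1r.
Qed.

Lemma EuD c v : Eu (D c v) = D c (Eu v).
Proof.
rewrite /Eu (lin_sum _ _ _ (linW _ _)); apply: eq_bigr => k _.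
by rewrite ED /glpar addbb sgF scale1r.
Qed.

(** [Eu] is the image of the identity matrix, which is central in gl(m,n). *)
Lemma EuE a b v : Eu (Eop a b v) = Eop a b (Eu v).
Proof.
rewrite /Eu (lin_sum _ _ _ (linE _ _)).
under eq_bigr => k _ do rewrite EE /glpar addbb sgF !scale1r.
rewrite big_split /= [Y in _ + Y]sumrB.
have -> : \sum_k (if k == a then Eop k b v else 0) = Eop a b v.
  by rewrite -big_mkcond big_pred1_eq.
have -> : \sum_k (if b == k then Eop a k v else 0) = Eop a b v.
  by rewrite -big_mkcond (big_pred1 b) // => k; rewrite eq_sym.
by rewrite subrr addr0.
Qed.

Lemma sum_delta (F : idx -> V) l : \sum_k (k == l)%:R *: F k = F l.
Proof.
rewrite (bigD1 l) //= eqxx scale1r big1 ?addr0 // => k /negPf ->.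
by rewrite scale0r.
Qed.

(** Sum of [EkW] over [k]: the partial degrees add up to [tdeg x], while [k = l] contributes the
    [- 1] and the last term. *)
Lemma EuW x l v : Eu (aW x l v) = aW x l (Eu v) + (((tdeg x)%:R - 1) *: aW x l v
  - \sum_k (mono_der k x).1 *: X k (aW (mono_der k x).2 l v) + aA x (D l v)).
Proof.
rewrite /Eu (lin_sum _ _ _ (linW _ _)).
under eq_bigr => k _ do rewrite EkW.
rewrite big_split /= big_split /= sumrB sum_delta -scaler_suml.
rewrite sumrB -natr_sum; congr (_ + (_ *: _ - _ + _)); congr (_ - _).
by rewrite (bigD1 l) //= eqxx big1 ?addr0 // => k /negPf ->.
Qed.

(** The odd variables are enumerated increasingly, so each one multiplied on the left precedes those
    already present and creates no sign. *)
Lemma KmonoE x v : Kmono KV x v = aA x v.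
Proof.
rewrite /Kmono /KV /=.
have -> : foldr (fun (j : 'I_n) u => X (inr j) u) v (enum x.2) = aA (fun=> 0%N, x.2) v.
  rewrite -[in RHS](set_enum x.2).
  have : sorted (fun p q : 'I_n => (p < q)%N) (enum x.2).
    rewrite /enum_mem; apply: sorted_filter; first by move=> a b c; apply: ltn_trans.
    by rewrite -enumT -(@sorted_map _ _ val ltn) val_enum_ord iota_ltn_sorted.
  elim: (enum _) => [|j s IH] hs /=.
    by rewrite (_ : [set:: [::]] = set0) ?aA1 //; apply/setP => j; rewrite !inE.
  have hj : all (fun q : 'I_n => (j < q)%N) s.
    by apply: (order_path_min _ hs) => a b c; apply: ltn_trans.
  rewrite IH ?(path_sorted hs) // aAM /mono_mul /= ninv1l.
  have -> : [disjoint [set j] & [set:: s]].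
    by rewrite disjoints1 inE; apply/negP => /(allP hj); rewrite ltnn.
  rewrite (_ : [set l in _ | _] = set0) ?cards0 ?sgF ?scale1r.
    by congr (aA _ v); apply: mono_eq => // ; apply/setP => q; rewrite !inE.
  apply/setP => q; rewrite !inE; apply/negP => /andP[/(allP hj)].
  by rewrite ltnNge => /negP h /ltnW.
have it (k : nat) (i : 'I_m) y : iter k (X (inl i)) (aA y v) =
    aA (fun p => (k * (p == i) + y.1 p)%N, y.2) v.
  elim: k => [|k IH] /=; first by congr (aA _ v); case: y => a I; apply: mono_eq.
  rewrite IH aAM /mono_mul /= disjoints_subset sub0set ninv0l sgF scale1r.
  congr (aA _ v); apply: mono_eq => [p|]; last by rewrite set0U.
  by rewrite /ei mulSn addnA.
(* Generalised from the full enumeration to any duplicate-free list, which records the even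
   variables already applied. *)
have -> : forall s, uniq s ->
    foldr (fun (i : 'I_m) u => iter (x.1 i) (X (inl i)) u) (aA (fun=> 0%N, x.2) v) s =
    aA (fun p => (x.1 p * (p \in s))%N, x.2) v.
  elim=> [|i s IH] /=; first by move=> _; congr (aA _ v); apply: mono_eq => // p; rewrite muln0.
  move=> /andP[ns us]; rewrite IH // it; congr (aA _ v); apply: mono_eq => // p /=.
  by rewrite inE; case: eqP => [->|_]; rewrite ?(negPf ns) ?muln0 ?addn0.
- by case: x => a I; congr (aA _ v); apply: mono_eq => // p; rewrite mem_enum muln1.
- exact: enum_uniq.
Qed.

End AWcalculus.

(** * The Euler operator is a scalar *)

Section EulerScalar.
Variables (m n : nat) (V : lmodType C) (G : bool -> V -> Prop).
Variables (aA : mono m n -> V -> V) (aW : mono m n -> idx m n -> V -> V).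
Hypothesis HAW : AWmodule G aA aW.
Hypothesis Vsimple : gsimple G (AWops aA aW).
Local Notation idx := (idx m n).
Local Notation mono := (mono m n).
Local Notation mono1 := (@mono1 m n).
Local Notation X k := (aA (mvar k)).
Local Notation D k := (aW mono1 k).
Local Notation Eu := (Eu aA aW).
Local Notation Eop := (Eop aA aW).
Implicit Types (x y : mono) (a b k l : idx) (u v : V).

Let sumW x l v := \sum_k (mono_der k x).1 *: X k (aW (mono_der k x).2 l v).

Lemma sumW_in (S : V -> Prop) x l v : subspace S ->
  (forall y u, S u -> S (aA y u)) ->
  (forall y, (tdeg y < tdeg x)%N -> S (aW y l v)) -> S (sumW x l v).
Proof.
move=> sS SA SW; apply: subspace_sum => // k _; case: (sS) => s0 [_ sZ].
have [h|h] := posnP (mdeg k x); first by rewrite (mono_der_eq0 h) scale0r.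
by apply: sZ; apply: SA; apply: SW; rewrite (tdeg_der h).
Qed.

(** Product of the commuting operators [Eu - (c + d)] for [d] in [ds]; repeated entries account for
    generalized eigenvectors. *)
Fixpoint evprod (c : C) (ds : seq nat) (v : V) : V :=
  if ds is d :: ds' then evprod c ds' (Eu v - (c + d%:R) *: v) else v.

Lemma evprod_lin c ds : lin (evprod c ds).
Proof.
by elim: ds => [|d ds IH] t u v //=; rewrite -IH (linEu HAW); congr evprod; lmod.
Qed.

Lemma evprod_comm (f : V -> V) c ds v : lin f -> (forall u, Eu (f u) = f (Eu u)) ->
  evprod c ds (f v) = f (evprod c ds v).
Proof.
move=> lf cf; elim: ds v => [|d ds IH] v //=.
by rewrite -IH (linB _ _ lf) (linZ _ _ lf) cf.
Qed.

Lemma evprod_Eu c ds v : Eu (evprod c ds v) = evprod c ds (Eu v).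
Proof. by rewrite evprod_comm //; apply: linEu HAW. Qed.

Lemma evprod_cat c s t v : evprod c (s ++ t) v = evprod c t (evprod c s v).
Proof. by elim: s v => //= d s IH v; rewrite IH. Qed.

Lemma evprod_par c ds : has_parity G (evprod c ds) false.
Proof.
elim: ds => [|d ds IH] b v hv /=; first by rewrite addbF.
apply: IH; have [sG _] := AW_grading HAW; apply: subspaceB => //.
  by rewrite -[b]addbF; apply: (parEu HAW).
by case: (sG b) => _ [_]; apply.
Qed.

(* The sum of the generalized eigenspaces of Eu for c, c + 1, c + 2, ... *)
Definition Fil c v := exists ds, evprod c ds v = 0.

Lemma Fil_subspace c : subspace (Fil c).
Proof.
split; first by exists [::].
split=> [u v [s hs] [t ht]|k v [s hs]]; last first.
  by exists s; rewrite (linZ _ _ (evprod_lin c s)) hs scaler0.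
(* The concatenated list kills both vectors because the two products commute. *)
exists (s ++ t); rewrite (linD _ _ (evprod_lin c _)) !evprod_cat hs.
rewrite (lin0 (evprod_lin c t)) add0r -evprod_comm.
- by rewrite ht (lin0 (evprod_lin c s)).
- exact: evprod_lin.
- exact: evprod_Eu.
Qed.

Lemma Fil_step c d v : Fil c (Eu v - (c + d%:R) *: v) -> Fil c v.
Proof. by case=> ds hds; exists (d :: ds). Qed.

Lemma Fil_comm (f : V -> V) c v : lin f -> (forall u, Eu (f u) = f (Eu u)) ->
  Fil c v -> Fil c (f v).
Proof. by move=> lf cf [ds h]; exists ds; rewrite evprod_comm // h lin0. Qed.

Lemma Fil_A c y v : Fil c v -> Fil c (aA y v).
Proof. by apply: Fil_comm; [exact: (linA HAW) | exact: (EuA HAW)]. Qed.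

Lemma Fil_D c k v : Fil c v -> Fil c (D k v).
Proof. by apply: Fil_comm; [exact: (linW HAW) | exact: (EuD HAW)]. Qed.

(* By EuW, ad Eu - (|x| - 1) sends the action of x d_l to operators built from
   monomials of smaller degree. *)
Lemma Fil_W c x l v : Fil c v -> Fil c (aW x l v).
Proof.
have [k] := ubnP (tdeg x); elim: k x l v => // k IH x l v hk.
case et: (tdeg x) => [|t]; first by rewrite (tdeg0 et); apply: Fil_D.
have sF := Fil_subspace c; case: (sF) => F0 [FD _].
move=> [ds]; elim: ds v => [|d ds IHd] v /= hv.
  by rewrite hv (lin0 (linW HAW x l)).
have Fv : Fil c v by exists (d :: ds).
(* The degree of [x] is [t.+1], so [x d_l] shifts the eigenvalue [c + d] by [t], up to terms of
   lower degree. *)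
have Fv' := IHd _ hv; apply: (@Fil_step c (d + t)).
have -> : Eu (aW x l v) - (c + (d + t)%:R) *: aW x l v =
   aW x l (Eu v - (c + d%:R) *: v) + (aA x (D l v) - sumW x l v).
  rewrite (EuW HAW) et (linB _ _ (linW HAW x l)) (linZ _ _ (linW HAW x l)) /sumW.
  by rewrite -addn1 !natrD; lmod.
apply: (FD) => //; apply: subspaceB => //; first by apply/Fil_A/Fil_D.
apply: sumW_in => // [y u|y hy]; first exact: Fil_A.
by apply: IH => //; apply: leq_trans hy _; rewrite -ltnS.
Qed.

Lemma AW_simple (S : V -> Prop) : subspace S -> gstable G S ->
  (forall x v, S v -> S (aA x v)) -> (forall x l v, S v -> S (aW x l v)) ->
  (exists2 v, S v & v <> 0) -> forall v, S v.
Proof.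
move=> sS gS SA SW [v Sv nv]; case: Vsimple => _ /(_ S sS gS) [].
- by case=> [x|[x k]] u /=; [exact: SA | exact: SW].
- by move=> /(_ v Sv).
- by [].
Qed.

Variables (c : C) (v0 : V).
Hypotheses (v0_neq0 : v0 <> 0) (Eu_v0 : Eu v0 = c *: v0).

(** A nonzero such [v] would make the graded submodule [Fil (c + 1)] all of [V]; but [v0], of
    eigenvalue [c], is killed by no [evprod (c + 1) s]. *)
Lemma Eu_higher (e : nat) v : Eu v = (c + 1 + e%:R) *: v -> v = 0.
Proof.
move=> hv; apply: contrapT => nv.
have sF := Fil_subspace (c + 1).
have FV : forall u, Fil (c + 1) u.
  apply: AW_simple => //.
  - move=> u [ds hu].
    have [] := kernel_gstable (AW_grading HAW) (@evprod_lin _ ds) (@evprod_par _ ds) hu.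
    move=> a [b [ha [hb [h1 h2]]]]; exists a, b.
    by split; [exists ds|split; [exists ds|]].
  - by move=> x u; apply: Fil_A.
  - by move=> x l u; apply: Fil_W.
  - by exists v => //; exists [:: e]; rewrite /= hv subrr.
have [ds] := FV v0.
suff h (s : seq nat) : exists2 z : C, z != 0 & evprod (c + 1) s v0 = z *: v0.
  have [z nz ->] := h ds => /eqP; rewrite scaler_eq0 (negPf nz) => /eqP.
  exact: v0_neq0.
elim: s => [|d s [z nz IH]] /=; first by exists 1; rewrite ?oner_eq0 ?scale1r.
(* The new factor is [c - (c + 1 + d)]. *)
exists (- (d.+1)%:R * z); first by rewrite mulf_neq0 // oppr_eq0 pnatr_eq0.
rewrite Eu_v0 -scalerBl (linZ _ _ (evprod_lin _ s)) IH scalerA -natr1.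
by congr (_ *: _); ring.
Qed.

(** The [c]-eigenspace is a graded submodule containing [v0]. Its stability under [x d_l] goes by
    induction on the degree of [x]. *)
Lemma Eu_scalar v : Eu v = c *: v.
Proof.
have sQ : subspace (fun u => Eu u = c *: u).
  split; first by rewrite (lin0 (linEu HAW)) scaler0.
  split=> [u w hu hw|k u hu]; first by rewrite (linD _ _ (linEu HAW)) hu hw scalerDr.
  by rewrite (linZ _ _ (linEu HAW)) hu !scalerA mulrC.
apply: (@AW_simple (fun u => Eu u = c *: u)) => //; last by exists v0.
- by apply: (eigen_gstable (AW_grading HAW)); [exact: linEu HAW|exact: parEu HAW].
- by move=> x u hu; rewrite (EuA HAW) hu (linZ _ _ (linA HAW _)).
move=> x l; have [k] := ubnP (tdeg x); elim: k x l => // k IH x l hk u hu.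
have QA y w : Eu w = c *: w -> Eu (aA y w) = c *: aA y w.
  by move=> hw; rewrite (EuA HAW) hw (linZ _ _ (linA HAW _)).
have QD j w : Eu w = c *: w -> Eu (D j w) = c *: D j w.
  by move=> hw; rewrite (EuD HAW) hw (linZ _ _ (linW HAW _ _)).
(* Degrees 0 and 1 are separate: there [Eu] commutes with the operators directly, whereas
   [Eu_higher] needs a positive shift of eigenvalue. *)
case et: (tdeg x) => [|[|t]]; first by rewrite (tdeg0 et) QD.
  have [a ->] := tdeg1 et.
  have -> : aW (mvar a) l u = Eop a l u + X a (D l u) by rewrite /Eop subrK.
  rewrite (linD _ _ (linEu HAW)) (EuE HAW) hu (linZ _ _ (linE HAW _ _)).
  by rewrite QA ?QD // [RHS]scalerDr.
have low : Eu (aA x (D l u) - sumW x l u) = c *: (aA x (D l u) - sumW x l u).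
  apply: (subspaceB sQ); first by rewrite QA ?QD.
  apply: (@sumW_in (fun w => Eu w = c *: w)) => // y hy.
  by apply: IH => //; apply: leq_trans hy _; rewrite -ltnS.
have e1 : Eu (aW x l u) = (c + t.+1%:R) *: aW x l u + (aA x (D l u) - sumW x l u).
  by rewrite (EuW HAW) et hu (linZ _ _ (linW HAW _ _)) /sumW -addn1 natrD; lmod.
(* By [e1] and [low], the defect [Eu w - c w] of [w = aW x l u] is an eigenvector for
   [c + 1 + t]. *)
apply/eqP; rewrite -subr_eq0; apply/eqP; apply: (@Eu_higher t).
rewrite (linB _ _ (linEu HAW)) (linZ _ _ (linEu HAW)) {1}e1 (linD _ _ (linEu HAW)) low.
rewrite (linZ _ _ (linEu HAW)) e1 -addn1 natrD; lmod.
Qed.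

(** Euler's identity on the module; in degree zero both coefficients vanish. *)
Lemma XdA k x v : (mono_der k x).1 *: X k (aA (mono_der k x).2 v) = (mdeg k x)%:R *: aA x v.
Proof.
have [h|h] := posnP (mdeg k x); first by rewrite (mono_der_eq0 h) h !scale0r.
rewrite (aAM HAW) scalerA; have := der_app_mvar h; rewrite /der_app => -[e1 e2].
by rewrite e1 [mono_mul _ _]surjective_pairing /= e2.
Qed.

Lemma W_formula x l v : aW x l v = aA x (D l v)
  + \sum_k (fsg x k * (mono_der k x).1) *: aA (mono_der k x).2 (Eop k l v).
Proof.
have [k] := ubnP (tdeg x); elim: k x l v => // k IH x l v hk.
case et: (tdeg x) => [|[|t]].
- rewrite (tdeg0 et) (aA1 HAW) big1 ?addr0 // => j _.
  by rewrite mono_der1 mulr0 scale0r.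
- have [a ->] := tdeg1 et.
  under eq_bigr => j _ do rewrite mono_der_mvar mulrC -scalerA.
  rewrite sum_delta mono_der_mvar2 (aA1 HAW) /fsg mpar_mvar.
  by rewrite andbN sgF scale1r /Eop addrC subrK.
(* As [Eu] is a scalar, the correction term in [EuW] must vanish. *)
have e1 : t.+1%:R *: aW x l v = sumW x l v - aA x (D l v).
  have := EuW HAW x l v; rewrite !Eu_scalar (linZ _ _ (linW HAW _ _)) et.
  rewrite -[LHS]addr0 => /addrI; rewrite -/(sumW x l v) -addn1 natrD addrK => e.
  by rewrite -[RHS]add0r e; lmod.
have nt : t.+1%:R != 0 :> C by rewrite pnatr_eq0.
apply: (scalerI nt); rewrite e1 scalerDr scaler_sumr.
(* The terms of lower degree are expanded by induction. On the other side [t.+1], the degree of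
   [mono_der k x], is split over the variables, so that the double sums match. *)
have -> : sumW x l v = \sum_j (mdeg j x)%:R *: aA x (D l v) +
    \sum_k t.+1%:R *: ((fsg x k * (mono_der k x).1) *: aA (mono_der k x).2 (Eop k l v)).
  have -> : \sum_k t.+1%:R *: ((fsg x k * (mono_der k x).1) *: aA (mono_der k x).2 (Eop k l v)) =
     \sum_k \sum_j (mdeg j (mono_der k x).2)%:R *:
        ((fsg x k * (mono_der k x).1) *: aA (mono_der k x).2 (Eop k l v)).
    apply: eq_bigr => i _; rewrite -scaler_suml -natr_sum.
    have [h|h] := posnP (mdeg i x); first by rewrite (mono_der_eq0 h) mulr0 scale0r !scaler0.
    by have := tdeg_der h; rewrite et => -[->].
  rewrite exchange_big -big_split; apply: eq_bigr => j _ /=.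
  have [h|h] := posnP (mdeg j x).
    rewrite (mono_der_eq0 h) h !scale0r add0r big1 // => i _.
    by rewrite mdeg_der h scale0r.
  rewrite IH; last by move: hk; rewrite (tdeg_der h) ltnS.
  rewrite (linD _ _ (linA HAW _)) scalerDr XdA; congr (_ + _).
  rewrite (lin_sum _ _ _ (linA HAW _)) scaler_sumr; apply: eq_bigr => i _.
  rewrite (linZ _ _ (linA HAW _)) mono_der_swap2.
  (* Removing an odd [x_j] flips the parity of [x]; this sign cancels the one from interchanging the
     derivatives. *)
  have -> : fsg (mono_der j x).2 i = fsg x i * sg (ipar i && ipar j).
    by rewrite /fsg mpar_der // -sgD; case: (ipar i); case: (ipar j); case: (mpar x).
  have e : (mono_der j x).1 * (mono_der i (mono_der j x).2).1 =
    sg (ipar i && ipar j) * ((mono_der i x).1 * (mono_der j (mono_der i x).2).1).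
    exact: mono_der_swap1.
  have := XdA j (mono_der i x).2 (Eop i l v); set z := X j _ => ez.
  have -> : (mdeg j (mono_der i x).2)%:R *: ((fsg x i * (mono_der i x).1) *:
      aA (mono_der i x).2 (Eop i l v)) =
      (fsg x i * (mono_der i x).1) *: ((mono_der j (mono_der i x).2).1 *: z).
    by rewrite ez; lmod.
  rewrite !scalerA; congr (_ *: _); rewrite -mulrA.
  transitivity (fsg x i * sg (ipar i && ipar j) *
      ((mono_der j x).1 * (mono_der i (mono_der j x).2).1)).
    by ring.
  rewrite e -[RHS]mul1r -(sgK (ipar i && ipar j)); ring.
(* The partial degrees sum to [t.+2]; subtracting [aA x (D l v)] leaves the required [t.+1]. *)
rewrite -scaler_suml -natr_sum -/(tdeg x) et.
have -> : t.+2%:R = t.+1%:R + 1 :> C by rewrite natr1.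
by rewrite scalerDl scale1r addrAC addrK.
Qed.

End EulerScalar.

(** * Words in the Weyl superalgebra *)

Lemma map_lcomb (U Z : lmodType C) (f : U -> Z) (I : Type) (h : I -> U) s :
  (forall (c : C) x y, f (c *: x + y) = c *: f x + f y) ->
  f (lcomb h s) = lcomb (fun i => f (h i)) s.
Proof.
move=> lf; have f0 : f 0 = 0.
  have := lf (-1) 0 0; rewrite scaler0 addr0 scaleN1r addNr; exact.
rewrite /lcomb; elim: s => [|x s IH]; first by rewrite !big_nil.
by rewrite !big_cons lf IH.
Qed.

Lemma lcomb_map (U : lmodType C) (I J : Type) (h : J -> U) (t : I -> J) s :
  lcomb h [seq (x.1, t x.2) | x <- s] = lcomb (fun i => h (t i)) s.
Proof. by rewrite /lcomb big_map. Qed.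

Lemma lcomb1 (U : lmodType C) (I : Type) (h : I -> U) i : lcomb h [:: (1, i)] = h i.
Proof. by rewrite /lcomb big_seq1 scale1r. Qed.

Lemma lcomb_in (U : lmodType C) (I : Type) (h : I -> U) (S : U -> Prop) s :
  subspace S -> (forall i, S (h i)) -> S (lcomb h s).
Proof.
move=> sS hS; apply: subspace_sum => // x _; by case: sS => _ [_]; apply.
Qed.

(** Induction on the length: all terms sharing the label of the first one are removed together. *)
Lemma lcomb_partition (Z : lmodType C) (I : Type) (T : eqType) (t : I -> T) (g : I -> Z) s :
  (forall d, lcomb g [seq x <- s | t x.2 == d] = 0) -> lcomb g s = 0.
Proof.
have [k] := ubnP (size s); elim: k s => // k IH [|x s] hk h; first by rewrite /lcomb big_nil.
have e := h (t x.2); rewrite /lcomb (bigID (fun y : C * I => t y.2 == t x.2)) /=.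
rewrite -[Y in Y + _]big_filter -[Y in _ + Y]big_filter [Y in Y + _]e add0r; apply: IH => [|d].
  rewrite /= eqxx /=; apply: leq_trans (_ : size s < k)%N => //.
  by rewrite ltnS size_filter count_size.
rewrite -filter_predI; have [->|nd] := eqVneq d (t x.2).
  rewrite (eq_filter (a2 := pred0)) ?filter_pred0 ?/lcomb ?big_nil // => y /=.
  by case: eqP.
rewrite -(h d); congr lcomb; apply: eq_filter => y /=.
by case: eqP => //= ->; rewrite nd.
Qed.

Lemma lcomb_filter_neq0 (Z : lmodType C) (I : Type) (a : pred I) (g : I -> Z) s :
  lcomb g [seq x <- s | a x.2] <> 0 -> exists2 i, a i & g i <> 0.
Proof.
move=> h; apply: contrapT => n; apply: h; rewrite /lcomb big_filter big1 // => x ax.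
have [->|nx] := pselect (g x.2 = 0); first by rewrite scaler0.
by case: n; exists x.2.
Qed.

Lemma span_gstable (V : lmodType C) (G : bool -> V -> Prop) (I : Type) (f : I -> V) :
  grading G ->
  (forall i, exists u v, (exists s, u = lcomb f s) /\ (exists s, v = lcomb f s) /\
     G false u /\ G true v /\ f i = u + v) ->
  gstable G (fun v => exists s, v = lcomb f s).
Proof.
move=> [sG _] hf _ [s ->]; have [_ [sD sZ]] := lcomb_subspace f.
case: (sG false) => F0 [FD FZ]; case: (sG true) => T0 [TD TZ].
elim: s => [|[c i] s [u [v [su [sv [Gu [Gv e]]]]]]].
  exists 0, 0; rewrite /lcomb big_nil addr0.
  by do 2!(split; first by exists [::]; rewrite big_nil).
have [u' [v' [su' [sv' [Gu' [Gv' e']]]]]] := hf i.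
exists (c *: u' + u), (c *: v' + v); split; first by apply/sD => //; apply: sZ.
split; first by apply/sD => //; apply: sZ.
split; first by apply: FD => //; apply: FZ.
split; first by apply: TD => //; apply: TZ.
by rewrite /lcomb big_cons -/(lcomb f s) /= e e'; lmod.
Qed.

Lemma weight_sum (V : lmodType C) (J : Type) (h : J -> V -> V) (I : Type) (s : seq I)
    (f : I -> V) (wt : I -> J -> C) v :
  (forall i, wspace h (wt i) (f i)) -> v = \sum_(i <- s) f i ->
  exists (k : nat) (vs : 'I_k -> V) (ws : 'I_k -> J -> C),
    (forall i, wspace h (ws i) (vs i)) /\ v = \sum_(i < k) vs i.
Proof.
move=> hw ->; exists (size s), (fun i => f (tnth (in_tuple s) i)).
by exists (fun i => wt (tnth (in_tuple s) i)); split=> //; rewrite big_tnth.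
Qed.

Section WeylWords.
Variables (m n : nat) (V : lmodType C) (G : bool -> V -> Prop).
Variable K : Kgen m n -> V -> V.
Hypothesis HK : Kmodule G K.
Local Notation idx := (idx m n).
Local Notation Kgen := (Kgen m n).
Local Notation wt := {ffun idx -> C}.
Local Notation word := (seq Kgen).
Implicit Types (g h : Kgen) (p r : word) (v : V) (k : idx) (mu : wt).

Lemma K_grading : grading G. Proof. by case: HK. Qed.
Lemma linK g : lin (K g). Proof. by case: HK => _ []. Qed.
Lemma parK g : has_parity G (K g) (ipar g.1). Proof. by case: HK => _ [_ []]. Qed.

Lemma K_DX (a b : idx) v : K (a, true) (K (b, false) v) =
  sg (ipar a && ipar b) *: K (b, false) (K (a, true) v) + (a == b)%:R *: v.
Proof.
case: HK => _ [_ [_ [_ [_ /(_ a b v)]]]]; rewrite /scomm => /eqP.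
by rewrite subr_eq addrC => /eqP ->; case: eqP; rewrite ?scale1r ?scale0r.
Qed.

Lemma K_comm g h v : h != (g.1, ~~ g.2) ->
  K g (K h v) = sg (ipar g.1 && ipar h.1) *: K h (K g v).
Proof.
case: g h => [a b] [a' b'] /= ne.
case: HK => _ [_ [_ [hX [hD _]]]].
have [eb|nb] := eqVneq b b'.
  by rewrite eb; apply/eqP; rewrite -subr_eq0; apply/eqP; case: (b'); [exact: hD|exact: hX].
have eb : b' = ~~ b by case: (b) (b') nb => [] [].
have na : a' != a by apply: contraNneq ne => ->; rewrite eb.
rewrite eb; case: (b) => /=; first by rewrite K_DX eq_sym (negPf na) scale0r addr0.
by rewrite K_DX (negPf na) scale0r addr0 andbC sgM.
Qed.

Definition gdeg g k : C := if g.1 == k then (if g.2 then -1 else 1) else 0.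

Lemma Kh_K k g v : Kh K k (K g v) = K g (Kh K k v) + gdeg g k *: K g v.
Proof.
case: g => [j []]; rewrite /Kh /gdeg /=.
  rewrite [K (k, true) _]K_comm /=; last by rewrite /= xpair_eqE andbF.
  rewrite K_DX !(linZ _ _ (linK _)) andbC.
  by case: eqP => [->|_] /=; lmod.
rewrite K_DX (linD _ _ (linK _)) !(linZ _ _ (linK _)).
rewrite [K (k, false) (K (j, false) _)]K_comm; last by rewrite xpair_eqE andbF.
by rewrite sgM [j == k]eq_sym; case: eqP => [->|_] //; rewrite !scale0r.
Qed.

Lemma linKh k : lin (Kh K k).
Proof. by move=> c u v; rewrite /Kh !linK. Qed.

Lemma Kh_comm j k v : Kh K j (Kh K k v) = Kh K k (Kh K j v).
Proof.
rewrite {2}/Kh Kh_K Kh_K (linD _ _ (linK _)) (linZ _ _ (linK _)).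
rewrite -/(Kh K k (Kh K j v)) -/(Kh K k v) /gdeg /=; case: eqP => _; lmod.
Qed.

Definition act p v : V := foldr (fun g u => K g u) v p.

Lemma act_cat p r v : act (p ++ r) v = act p (act r v).
Proof. exact: foldr_cat. Qed.

Lemma act_lin p : lin (act p).
Proof. by elim: p => [|g p IH] c u v //=; rewrite IH linK. Qed.

Definition wpar p : bool := foldr (fun g b => ipar g.1 (+) b) false p.

Lemma act_par p : has_parity G (act p) (wpar p).
Proof.
elim: p => [|g p IH] b v hv /=; first by rewrite addbF.
by rewrite [ipar _ (+) _]addbC addbA; apply/parK/IH.
Qed.

Definition wdeg p : wt := [ffun k => \sum_(g <- p) gdeg g k].

Lemma wdeg_cat p r : wdeg (p ++ r) = wdeg p + wdeg r.
Proof. by apply/ffunP => k; rewrite !ffunE big_cat. Qed.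

Lemma wdeg_nil : wdeg [::] = 0.
Proof. by apply/ffunP => k; rewrite !ffunE big_nil. Qed.

Lemma act_weight p mu v : wspace (Kh K) mu v -> wspace (Kh K) (mu + wdeg p) (act p v).
Proof.
move=> hv; elim: p => [|g p IH] k /=; first by rewrite wdeg_nil addr0; apply: hv.
rewrite Kh_K IH (linZ _ _ (linK _)) -scalerDl; congr (_ *: _).
by rewrite !ffunE big_cons; ring.
Qed.

(** The point is that [c] depends on the weight only, not on the vector. *)
Lemma K_pair k b mu : exists c, forall v, wspace (Kh K) mu v ->
  K (k, b) (K (k, ~~ b) v) = c *: v.
Proof.
case: b => /=.
  exists (sg (ipar k && ipar k) * mu k + 1) => v hv.
  by rewrite K_DX eqxx -[K (k, false) _]/(Kh K k v) hv /=; lmod.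
by exists (mu k) => v hv; rewrite -hv.
Qed.

Lemma K_act g p : (g.1, ~~ g.2) \notin p ->
  exists e, forall v, K g (act p v) = e *: act p (K g v).
Proof.
elim: p => [|h p IH] /=; first by exists 1 => v; rewrite scale1r.
rewrite inE negb_or eq_sym => /andP[nh /IH [e he]].
exists (sg (ipar g.1 && ipar h.1) * e) => v.
by rewrite K_comm // he (linZ _ _ (linK _)) scalerA.
Qed.

(** Without the dual letter, contributions to the coordinate [g.1] all have the same sign and cannot
    cancel. *)
Lemma wdeg_notin g p : (g.1, ~~ g.2) \notin p ->
  exists c : nat, wdeg p g.1 = gdeg g g.1 * c%:R.
Proof.
elim: p => [|h p IH]; first by exists 0%N; rewrite ffunE big_nil mulr0.
rewrite inE negb_or => /andP[nh /IH [c]]; rewrite !ffunE big_cons => ->.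
move: nh {IH}; rewrite /gdeg eqxx; case: g h => [k b] [k' b'] /=.
have [->|_] := eqVneq k' k; last by exists c; rewrite add0r.
move=> nb; exists c.+1; have -> : b' = b by case: b b' nb => [] []; rewrite ?eqxx.
by case: (b); rewrite -natr1; ring.
Qed.

(* A word of degree zero contains, next to its first letter g up to commutation,
   the letter dual to g; the two cancel into a scalar. *)
Lemma deg0_scalar p : wdeg p = 0 ->
  forall mu, exists c, forall v, wspace (Kh K) mu v -> act p v = c *: v.
Proof.
have [k] := ubnP (size p); elim: k p => // k IH [|g p] hk hp mu.
  by exists 1 => v _; rewrite scale1r.
pose g' : Kgen := (g.1, ~~ g.2).
have hg : g' \in p.
  apply/negPn/negP => /wdeg_notin [c hc].
  have := congr1 (fun f : wt => f g.1) hp; rewrite !ffunE big_cons.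
  have -> : \sum_(h <- p) gdeg h g.1 = gdeg g g.1 * c%:R by rewrite -hc ffunE.
  have -> : gdeg g g.1 + gdeg g g.1 * c%:R = gdeg g g.1 * c.+1%:R by rewrite -natr1; ring.
  move=> /eqP; rewrite mulf_eq0 pnatr_eq0 orbF /gdeg eqxx.
  by case: (g.2); rewrite ?oppr_eq0 oner_eq0.
(* Cutting at the first occurrence of [g'] leaves a prefix past which [g] moves up to a scalar. *)
have [u [w [ep nu]]] : exists u w, p = u ++ g' :: w /\ g' \notin u.
  elim: (p) hg => //= h s IHs; rewrite inE; have [<- _|nh /IHs [u [w [-> nu]]]] := eqVneq g' h.
    by exists [::], s.
  by exists (h :: u), w; rewrite inE negb_or nh.
have hd : wdeg (u ++ w) = 0.
  have e2 : wdeg [:: g; g'] = 0.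
    apply/ffunP => j; rewrite !ffunE !big_cons big_nil addr0 /gdeg /=.
    by case: eqP => _; case: (g.2) => /=; ring.
  have : wdeg [:: g; g'] + wdeg (u ++ w) = 0.
    rewrite -hp ep; apply/ffunP => j; rewrite !ffunE !big_cons big_nil !big_cat !big_cons /=.
    by ring.
  by rewrite e2 add0r.
have [|c hc] := IH (u ++ w) _ hd mu.
  by move: hk; rewrite ep /= !size_cat /= addnS ltnS => /ltnW.
have [e he] := K_act nu.
have [c' hc'] := K_pair g.1 g.2 (mu + wdeg w).
exists (e * c' * c) => v hv.
have -> : act (g :: p) v = e *: act u (K g (K g' (act w v))).
  by rewrite ep /= act_cat he.
have -> : K g (K g' (act w v)) = c' *: act w v.
  have {1}-> : g = (g.1, g.2) by case: (g).
  by rewrite hc' //; apply: act_weight.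
by rewrite (linZ _ _ (act_lin _)) -act_cat hc // !scalerA.
Qed.

Section Component.
Variables (I : Type) (f : I -> V) (wI : I -> wt).
Hypothesis hI : forall i, wspace (Kh K) (wI i) (f i).

(** With [S] the zero subspace, this says that a relation between weight vectors holds in each
    weight separately. *)
Lemma component (S : V -> Prop) s d : subspace S -> (forall k v, S v -> S (Kh K k v)) ->
  S (lcomb f s) -> S (lcomb f [seq x <- s | wI x.2 == d]).
Proof.
move=> sS hS; rewrite {1}/lcomb (bigID (fun x : C * I => wI x.2 == d)) /=.
rewrite -big_filter -/(lcomb f _) => h.
apply: (@weight_component _ _ (Kh K) S d _ _ s (fun x : C * I => wI x.2 != d)
  (fun x => x.1 *: f x.2) (fun x => wI x.2)) => //.
- exact: linKh.
- move=> k; rewrite /lcomb big_filter (lin_sum _ _ _ (linKh k)) scaler_sumr.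
  by apply: eq_bigr => x /eqP e; rewrite (linZ _ _ (linKh k)) hI e !scalerA mulrC.
- by move=> x k; rewrite (linZ _ _ (linKh k)) hI !scalerA mulrC.
- by move=> x /eqP nx e; apply: nx; apply/ffunP => k; rewrite e.
Qed.

End Component.
End WeylWords.

(** * The tensor decomposition *)

Section Decomposition.
Variables (m n : nat) (V : lmodType C) (G : bool -> V -> Prop).
Variables (K : Kgen m n -> V -> V) (E : idx m n -> idx m n -> V -> V).
Local Notation idx := (idx m n).
Local Notation Kgen := (Kgen m n).
Local Notation wt := {ffun idx -> C}.
Local Notation word := (seq Kgen).
Local Notation act := (act K).
Hypothesis HK : Kmodule G K.
Hypothesis HE : glmodule G E.
Hypothesis EK : forall a b g v, E a b (K g v) = sg (glpar a b && ipar g.1) *: K g (E a b v).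
Hypothesis KE_simple : forall S : V -> Prop, subspace S -> gstable G S ->
  (forall g v, S v -> S (K g v)) -> (forall a b v, S v -> S (E a b v)) ->
  (exists2 v, S v & v <> 0) -> forall v, S v.
Variables (lam : wt) (kap : idx -> C) (q0 : bool) (v0 : V).
Hypotheses (v0_neq0 : v0 <> 0) (v0_par : G q0 v0).
Hypotheses (v0_lam : wspace (Kh K) lam v0) (v0_kap : wspace (glh E) kap v0).
Implicit Types (p r : word) (v y : V) (k : idx).

Let gG : grading G := K_grading HK.
Let linK := linK HK.
Let linKh := linKh HK.
Let act_lin p := act_lin HK p.

Lemma gl_lin a b : lin (E a b). Proof. by case: HE => _ []. Qed.
Lemma gl_par a b : has_parity G (E a b) (glpar a b). Proof. by case: HE => _ [_ []]. Qed.
Lemma gl_EE a b c d v : E a b (E c d v) = sg (glpar a b && glpar c d) *: E c d (E a b v)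
  + ((if b == c then E a d v else 0)
     - sg (glpar a b && glpar c d) *: (if d == a then E c b v else 0)).
Proof. by case: HE => _ [_ [_ <-]]; rewrite /scomm addrC subrK. Qed.

Lemma E_act a b p v : E a b (act p v) = sg (glpar a b && wpar p) *: act p (E a b v).
Proof.
elim: p => [|g p IH] /=; first by rewrite andbF sgF scale1r.
by rewrite EK IH (linZ _ _ (linK g)) scalerA -sgD andb_addr.
Qed.

Lemma E_Kh a b k v : E a b (Kh K k v) = Kh K k (E a b v).
Proof. by rewrite /Kh EK EK (linZ _ _ (linK _)) sgM. Qed.

Lemma wspace_subspace mu : subspace (wspace (Kh K) mu).
Proof.
split; first by move=> k; rewrite (lin0 (linKh k)) scaler0.
split=> [u v hu hv k|c v hv k]; first by rewrite (linD _ _ (linKh k)) hu hv scalerDr.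
by rewrite (linZ _ _ (linKh k)) hv !scalerA mulrC.
Qed.

Lemma parKh k : has_parity G (Kh K k) false.
Proof.
move=> b v hv; rewrite -(addbb (ipar k)) addbA.
exact/(parK HK (k, false))/(parK HK (k, true)).
Qed.

Lemma wspace_gstable mu : gstable G (wspace (Kh K) mu).
Proof.
by apply: gstable_forall => // k; apply: eigen_gstable => //; apply: parKh.
Qed.

Lemma zero_subspace : subspace (fun u : V => u = 0).
Proof. by split=> //; split=> [u w -> ->|c u ->]; rewrite ?addr0 ?scaler0. Qed.

Lemma Kh_zero k u : u = 0 -> Kh K k u = 0.
Proof. by move=> ->; rewrite (lin0 (linKh k)). Qed.

Lemma component_eq (I : Type) (f : I -> V) (wI : I -> wt) (d : wt) s v :
  (forall i, wspace (Kh K) (wI i) (f i)) -> wspace (Kh K) d v ->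
  v = lcomb f s -> v = lcomb f [seq x <- s | wI x.2 == d].
Proof.
move=> hI hv e.
(* The index [None], with coefficient -1, turns the expression of [v] into a relation to which
   [component] applies. *)
pose f' (o : option I) := if o is Some i then f i else v.
pose w' (o : option I) := if o is Some i then wI i else d.
pose s' := (-1, None) :: [seq (x.1, Some x.2) | x <- s].
have h0 : lcomb f' s' = 0.
  rewrite /lcomb big_cons -/(lcomb _ _) lcomb_map /= scaleN1r.
  by apply/eqP; rewrite addrC subr_eq0; apply/eqP.
have hI' o : wspace (Kh K) (w' o) (f' o) by case: o.
have := @component _ _ _ _ _ HK _ f' w' hI' _ s' d zero_subspace Kh_zero h0.
rewrite /s' /= eqxx /lcomb big_cons /= filter_map -/(lcomb _ _) lcomb_map scaleN1r => /eqP.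
by rewrite addrC subr_eq0 => /eqP.
Qed.

Definition Kspan (Y : V -> Prop) v : Prop :=
  exists s, v = lcomb (fun i : word * {y | Y y} => act i.1 (sval i.2)) s.

(** The operators [E a b] pass through words up to sign and then preserve [Y], so the span is stable
    under both actions. *)
Lemma Kspan_full (Y : V -> Prop) : gstable G Y -> (forall a b y, Y y -> Y (E a b y)) ->
  (exists2 y, Y y & y <> 0) -> forall v, Kspan Y v.
Proof.
move=> gY EY [y Yy ny]; have sS := lcomb_subspace (fun i : word * {y | Y y} => act i.1 (sval i.2)).
have inS p z : Y z -> Kspan Y (act p z).
  by move=> Yz; exists [:: (1, (p, exist _ z Yz))]; rewrite lcomb1.
apply: KE_simple => //.
- apply: span_gstable => // -[p [z Yz]] /=.
  have [u [w [Yu [Yw [Gu [Gw ->]]]]]] := gY z Yz.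
  have pu := act_par HK p Gu; have pw := act_par HK p Gw.
  rewrite (linD _ _ (act_lin p)); case: (wpar p) pu pw => /= pu pw.
    exists (act p w), (act p u); split; first exact: inS.
    by split; first exact: inS; rewrite addrC.
  exists (act p u), (act p w); split; first exact: inS.
  by split; first exact: inS.
- move=> g _ [s ->].
  exists [seq (x.1, (g :: x.2.1, x.2.2)) | x <- s].
  rewrite (lcomb_map _ (fun i : word * {y | Y y} => (g :: i.1, i.2))).
  by rewrite (map_lcomb _ _ (linK g)).
- move=> a b _ [s ->]; rewrite (map_lcomb _ _ (gl_lin a b)).
  apply: lcomb_in => // -[p [z Yz]] /=; rewrite E_act.
  by case: sS => _ [_]; apply; apply/inS/EY.
- by exists y => //; apply: (inS [::]).
Qed.

Let inM := wspace (Kh K) lam.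

Lemma M_E a b y : inM y -> inM (E a b y).
Proof. by move=> hy k; rewrite -E_Kh hy (linZ _ _ (gl_lin a b)). Qed.

(* act p M generates V; the component of weight lam of an expression of v0 as
   such a combination involves a word r with r p a nonzero scalar on M. *)
Lemma word_inverse p : (exists2 y, inM y & act p y <> 0) ->
  exists r c, [/\ c != 0, wdeg r + wdeg p = 0 & forall y, inM y -> act r (act p y) = c *: y].
Proof.
move=> [y hy ny].
pose Y z := exists2 y, inM y & z = act p y.
have [|||s es] := @Kspan_full Y _ _ _ v0.
- move=> _ [u hu ->]; have [a [b [ha [hb [Ga [Gb ->]]]]]] := wspace_gstable hu.
  have pa := act_par HK p Ga; have pb := act_par HK p Gb.
  rewrite (linD _ _ (act_lin p)); case: (wpar p) pa pb => /= pa pb.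
    exists (act p b), (act p a); split; first by exists b.
    by split; [exists a|rewrite addrC].
  by exists (act p a), (act p b); split; [exists a|split; [exists b|]].
- move=> a b _ [u hu ->]; rewrite E_act -(linZ _ _ (act_lin p)).
  exists (sg (glpar a b && wpar p) *: E a b u) => //.
  by case: (wspace_subspace lam) => _ [_]; apply; apply: M_E.
- by exists (act p y) => //; exists y.
have hwt (i : word * {z | Y z}) :
    wspace (Kh K) (lam + wdeg p + wdeg i.1) (act i.1 (sval i.2)).
  case: i => r [z hz] /=; case: (hz) => u hu ez; rewrite ez.
  by apply: (act_weight HK); apply: (act_weight HK).
have e := component_eq hwt v0_lam es.
have [|[r [z hz]] /= /eqP er nz] := lcomb_filter_neq0
  (a := fun i : word * {z | Y z} => lam + wdeg p + wdeg i.1 == lam)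
  (g := fun i => act i.1 (sval i.2)) (s := s); first by rewrite -e.
have [u hu ez] := hz.
have d0 : wdeg r + wdeg p = 0.
  by apply: (addrI lam); rewrite addr0 [wdeg r + _]addrC addrA.
have [|c hc] := deg0_scalar HK (p := r ++ p) _ lam; first by rewrite wdeg_cat.
exists r, c; split=> // [|y' hy']; last by rewrite -act_cat hc.
apply/eqP => c0; apply: nz; rewrite ez /= -act_cat hc //.
by rewrite c0 scale0r.
Qed.

(** If some word [p0] of degree [d] is nonzero on the weight space, [word_inverse] supplies [r], and
    comparison through [r] makes every other word of degree [d] a multiple of [p0]. *)
Lemma degree_rep (d : wt) :
  (forall p, wdeg p = d -> forall y, inM y -> act p y = 0) \/
  exists p0 r c (e : word -> C), [/\ c != 0, forall y, inM y -> act r (act p0 y) = c *: y &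
    forall p, wdeg p = d -> forall y, inM y -> act p y = e p *: act p0 y].
Proof.
have [[p0 [ep0 [y0 hy0 ny0]]]|nex] :=
  pselect (exists p0, wdeg p0 = d /\ exists2 y, inM y & act p0 y <> 0); last first.
  left=> p ep y hy; apply: contrapT => np; apply: nex; exists p; split=> //.
  by exists y.
right; have [|r [c [nc er hr]]] := @word_inverse p0; first by exists y0.
have [|e0 he0] := deg0_scalar HK (p := p0 ++ r) _ (lam + d).
  by rewrite wdeg_cat addrC.
(* The two bracketings of [p0 r p0] on [y0] give [e0] and [c] times the nonzero vector
   [act p0 y0]. *)
have he : e0 = c.
  apply/eqP; rewrite -subr_eq0; apply/negPn/negP => ne; apply: ny0.
  apply/eqP; rewrite -(inj_eq (scalerI ne)) scaler0 scalerBl subr_eq0; apply/eqP.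
  rewrite -he0; last by rewrite -ep0; apply: (act_weight HK).
  by rewrite act_cat hr // (linZ _ _ (act_lin _)).
have ex p : exists e, wdeg p = d -> forall y, inM y -> act p y = e *: act p0 y.
  have [ep|np] := pselect (wdeg p = d); last by exists 0.
  have [|c' hc'] := deg0_scalar HK (p := r ++ p) _ lam.
    by rewrite wdeg_cat ep -ep0.
  (* On the weight space, [c p = p0 r p = c' p0]. *)
  exists (c^-1 * c') => _ y hy; apply: (scalerI nc).
  rewrite scalerA mulrA divff // mul1r -{1}he -he0; last by rewrite -ep; apply: (act_weight HK).
  by rewrite act_cat -[act r _]act_cat hc' // (linZ _ _ (act_lin _)).
have [e hep] := choice ex.
by exists p0, r, c, e.
Qed.

(** [Y] generates [V] over words; in weight [lam] only words of degree zero survive, and these act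
    on [Y] by scalars. *)
Lemma M_simple (Y : V -> Prop) : subspace Y -> gstable G Y ->
  (forall y, Y y -> inM y) -> (forall a b y, Y y -> Y (E a b y)) ->
  (exists2 y, Y y & y <> 0) -> forall y, inM y -> Y y.
Proof.
move=> sY gY YM EY neY y hy; have [s es] := Kspan_full gY EY neY y.
have := component_eq (wI := fun i : word * {z | Y z} => lam + wdeg i.1) _ hy es.
move=> ->; last by move=> [p [z Yz]] /=; apply: (act_weight HK) => //; apply: YM.
rewrite /lcomb big_filter; apply: subspace_sum => // -[c [p [z Yz]]] /= /eqP ep.
case: (sY) => _ [_ sZ]; apply: (sZ).
have [|c' ->] := deg0_scalar HK (p := p) _ lam; [|exact: sZ|exact: YM].
by apply: (addrI lam); rewrite addr0.
Qed.

(** * The factors [P] and [M] and their pairing into [V] *)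

Let vact p := act p v0.
Let sP := lcomb_subspace vact.
Let sM := wspace_subspace lam.
Let P : lmodType C := sub_lmod sP.
Let M : lmodType C := sub_lmod sM.
Let mkP : V -> P := sub_mk sP.
Let mkM : V -> M := sub_mk sM.

Lemma vact_wt p : wspace (Kh K) (lam + wdeg p) (vact p).
Proof. exact: (act_weight HK). Qed.

Lemma P_component s d : lcomb vact s = 0 -> lcomb vact [seq x <- s | wdeg x.2 == d] = 0.
Proof.
move=> e; have := @component _ _ _ _ _ HK _ vact (fun p => lam + wdeg p) vact_wt
  _ s (lam + d) zero_subspace Kh_zero e.
by rewrite (eq_filter (a2 := fun x => wdeg x.2 == d)) // => x; rewrite (inj_eq (addrI _)).
Qed.

Lemma P_rep s d p0 (e : word -> C) y : inM y ->
  (forall p, wdeg p = d -> forall y, inM y -> act p y = e p *: act p0 y) ->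
  lcomb (fun p => act p y) [seq x <- s | wdeg x.2 == d] =
  (\sum_(x <- s | wdeg x.2 == d) x.1 * e x.2) *: act p0 y.
Proof.
move=> hy he; rewrite /lcomb big_filter scaler_suml; apply: eq_bigr => x /eqP ex.
by rewrite he // scalerA.
Qed.

(** In each degree a relation on [v0] collapses to a scalar times [act p0 v0]; as [act r] sends this
    to a nonzero multiple of [v0], the scalar is 0, and the relation holds on every [w]. *)
Lemma P_extend s w : inM w -> lcomb vact s = 0 -> lcomb (fun p => act p w) s = 0.
Proof.
move=> hw e; apply: (lcomb_partition (t := @wdeg m n)) => d.
have ed := P_component d e.
have [h|[p0 [r [c [e' [nc hr he]]]]]] := degree_rep d.
  by rewrite /lcomb big_filter big1 // => x /eqP ex; rewrite h // scaler0.
rewrite (P_rep _ hw he); move: ed; rewrite (P_rep _ v0_lam he).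
move=> /(congr1 (act r)); rewrite (linZ _ _ (act_lin r)) hr // (lin0 (act_lin r)).
move=> /eqP; rewrite !scaler_eq0 (negPf nc) (negPf (introN eqP v0_neq0)) !orbF => /eqP ->.
by rewrite scale0r.
Qed.

Lemma b_exists : exists b : P -> M -> V,
  forall (u : P) (w : M) s, val u = lcomb vact s -> b u w = lcomb (fun p => act p (val w)) s.
Proof.
have ex (w : M) : exists h : V -> V, forall s, h (lcomb vact s) = lcomb (fun p => act p (val w)) s.
  by apply: lcomb_extension => s; apply: P_extend; apply: sub_valP.
have [h hh] := choice ex.
by exists (fun u w => h w (val u)) => u w s ->; apply: hh.
Qed.

Lemma P_repr (u : P) : exists s, val u = lcomb vact s.
Proof. exact: (sub_valP u). Qed.

Lemma P_vact p : val (mkP (vact p)) = vact p.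
Proof. by rewrite sub_mkK //; exists [:: (1, p)]; rewrite lcomb1. Qed.

Lemma P_lcomb (u : P) s : val u = lcomb vact s -> u = lcomb (fun p => mkP (vact p)) s.
Proof.
move=> e; apply: val_inj; rewrite (map_lcomb _ _ (@sub_val_lin _ _ sP)) e.
by rewrite /lcomb; apply: eq_bigr => x _; rewrite P_vact.
Qed.

Section Bilinear.
Variable b : P -> M -> V.
Hypothesis b_eq : forall (u : P) (w : M) s, val u = lcomb vact s ->
  b u w = lcomb (fun p => act p (val w)) s.

Lemma b_lin2 : lin2 b.
Proof.
split=> [c u u' w|c u w w'].
  have [s es] := P_repr u; have [s' es'] := P_repr u'.
  rewrite (b_eq w es) (b_eq w es') (b_eq w (s := [seq (c * x.1, x.2) | x <- s] ++ s')).
    by rewrite lcomb_cat lcomb_scale.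
  by rewrite sub_val_lin lcomb_cat lcomb_scale es es'.
have [s es] := P_repr u; rewrite !(b_eq _ es) sub_val_lin.
rewrite /lcomb scaler_sumr -big_split; apply: eq_bigr => x _ /=.
by rewrite act_lin; lmod.
Qed.

Lemma b_vact p w : b (mkP (vact p)) w = act p (val w).
Proof. by rewrite (b_eq w (s := [:: (1, p)])) ?lcomb1 ?P_vact. Qed.

Lemma V_lcomb v : exists s, v = lcomb (fun i : word * M => act i.1 (val i.2)) s.
Proof.
have [|||s ->] := @Kspan_full inM _ _ _ v.
- exact: wspace_gstable.
- exact: M_E.
- by exists v0.
exists [seq (x.1, (x.2.1, mkM (sval x.2.2))) | x <- s].
rewrite (lcomb_map _ (fun i : word * {y | inM y} => (i.1, mkM (sval i.2)))).
rewrite /lcomb; apply: eq_bigr => -[c [p [y hy]]] _ /=.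
by rewrite sub_mkK.
Qed.

Lemma b_tensor : is_tensor b.
Proof.
split; first exact: b_lin2.
move=> Z g [g1 g2].
pose f (i : word * M) := act i.1 (val i.2).
pose g' (i : word * M) := g (mkP (vact i.1)) i.2.
have [h1 h2] := b_lin2.
split; last first.
  move=> k1 k2 l1 l2 e1 e2 x; have [s ->] := V_lcomb x.
  rewrite (map_lcomb _ _ l1) (map_lcomb _ _ l2) /lcomb; apply: eq_bigr => y _.
  by rewrite -b_vact e1 e2.
have wd s : lcomb f s = 0 -> lcomb g' s = 0.
  move=> e; apply: (lcomb_partition (t := fun i : word * M => wdeg i.1)) => d.
  have ed : lcomb f [seq x <- s | wdeg x.2.1 == d] = 0.
    have hf i : wspace (Kh K) (lam + wdeg i.1) (f i).
      by apply: (act_weight HK) => //; apply: (sub_valP i.2).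
    have := @component _ _ _ _ _ HK _ f (fun i => lam + wdeg i.1) hf
      _ s (lam + d) zero_subspace Kh_zero e.
    by rewrite (eq_filter (a2 := fun x => wdeg x.2.1 == d)) // => x; rewrite (inj_eq (addrI _)).
  have [h|[p0 [r [c [e' [nc hr he]]]]]] := degree_rep d.
    have g0 w : g 0 w = 0.
      by have := g1 (-1) 0 0 w; rewrite scaler0 addr0 scaleN1r addNr; exact.
    rewrite /lcomb big_filter big1 // => x /eqP ex.
    rewrite /g' (_ : mkP _ = 0) ?g0 ?scaler0 //.
    by apply: val_inj; rewrite P_vact raddf0 /vact h.
  (* Writing each word as a multiple of [p0] gathers the relation into [act p0] of one vector of
     [M], which [act r] shows to be 0. *)
  pose t := [seq (x.1 * e' x.2.1, x.2.2) | x <- s & wdeg x.2.1 == d].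
  have et : lcomb id t = 0.
    apply: val_inj; rewrite raddf0 (map_lcomb _ _ (@sub_val_lin _ _ sM)).
    apply: (scalerI nc); rewrite scaler0 -hr; last first.
      by apply: lcomb_in => // w; apply: (sub_valP w).
    rewrite (_ : act p0 _ = 0) ?(lin0 (act_lin r)) // -{}ed.
    rewrite (map_lcomb _ _ (act_lin p0)) /lcomb big_map !big_filter.
    apply: eq_bigr => x /eqP ex; rewrite /f (he _ ex) ?scalerA //.
    exact: (sub_valP x.2.2).
  have -> : lcomb g' [seq x <- s | wdeg x.2.1 == d] = g (mkP (vact p0)) (lcomb id t).
    rewrite (map_lcomb (f := g (mkP (vact p0)))) // /lcomb big_map !big_filter.
    apply: eq_bigr => x /eqP ex; rewrite /g'.
    have -> : mkP (vact x.2.1) = e' x.2.1 *: mkP (vact p0) + 0.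
      by apply: val_inj; rewrite sub_val_lin !P_vact raddf0 addr0 /vact he.
    rewrite g1 scalerDr scalerA (_ : g 0 _ = 0) ?scaler0 ?addr0 //.
    by have := g1 (-1) 0 0 x.2.2; rewrite scaler0 addr0 scaleN1r addNr; exact.
  rewrite et.
  by have := g2 (-1) (mkP (vact p0)) 0 0; rewrite scaler0 addr0 scaleN1r addNr; exact.
have [h hh] := lcomb_extension wd; exists h; split=> [c x y|u w].
  have [s ->] := V_lcomb x; have [t ->] := V_lcomb y.
  rewrite -!/f -lcomb_scale -lcomb_cat !hh.
  by rewrite lcomb_cat lcomb_scale.
have [s es] := P_repr u; rewrite (b_eq w es).
pose s' := [seq (x.1, (x.2, w)) | x <- s].
have -> : lcomb (fun p => act p (val w)) s = lcomb f s'.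
  by rewrite (lcomb_map f (fun p : word => (p, w))).
rewrite hh (lcomb_map g' (fun p : word => (p, w))) [in RHS](P_lcomb es).
by rewrite (map_lcomb (f := fun u => g u w)).
Qed.

End Bilinear.

(* shifted so that v0 becomes even *)
Let GP (q : bool) (u : P) : Prop := G (q (+) q0) (val u).
Let GM (q : bool) (w : M) : Prop := G (q (+) false) (val w).
Let KP (g : Kgen) : P -> P := @sub_op _ _ sP (K g).
Let EM (a c : idx) : M -> M := @sub_op _ _ sM (E a c).

Lemma P_stable g v : (exists s, v = lcomb vact s) -> exists s, K g v = lcomb vact s.
Proof.
move=> [s ->]; exists [seq (x.1, g :: x.2) | x <- s].
by rewrite (lcomb_map _ (cons g)) (map_lcomb _ _ (linK g)).
Qed.

Lemma KPE g u : val (KP g u) = K g (val u).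
Proof. by apply: sub_opE => v; apply: P_stable. Qed.

Lemma EME a c w : val (EM a c w) = E a c (val w).
Proof. by apply: sub_opE => v; apply: M_E. Qed.

Lemma vact_par p : G (wpar p (+) q0) (vact p).
Proof. by rewrite addbC; apply: (act_par HK). Qed.

Lemma P_gstable : gstable G (fun v => exists s, v = lcomb vact s).
Proof.
apply: span_gstable => // p; have hp := vact_par p.
have z : exists s, 0 = lcomb vact s by exists [::]; rewrite /lcomb big_nil.
have v : exists s, vact p = lcomb vact s by exists [:: (1, p)]; rewrite lcomb1.
have G0 b : G b 0 by case: gG => /(_ b) [].
case: (wpar p (+) q0) hp => hp; [exists 0, (vact p) | exists (vact p), 0].
  by rewrite add0r.
by rewrite addr0.
Qed.

Lemma P_Kmodule : Kmodule GP KP.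
Proof.
have [_ [_ [_ [hX [hD hDX]]]]] := HK.
split; first exact: (sub_grading gG _ q0 P_gstable).
split; first by move=> g; apply: sub_op_lin => // v; apply: P_stable.
split; first by move=> g b u hu; rewrite /GP KPE addbAC; apply: (parK HK).
have vE (a b : Kgen) (c : C) (u : P) : val (KP a (KP b u) - c *: KP b (KP a u)) =
    K a (K b (val u)) - c *: K b (K a (val u)).
  by rewrite sub_valB !KPE.
split; first by move=> a b u; apply: val_inj; rewrite vE raddf0; apply: hX.
split; first by move=> a b u; apply: val_inj; rewrite vE raddf0; apply: hD.
move=> a b u; apply: val_inj; rewrite vE; have := hDX a b (val u).
by rewrite /scomm => ->; case: eqP => _ //; rewrite raddf0.
Qed.

Lemma P_weight : weight_mod (Kh KP).
Proof.
move=> u; have [s /P_lcomb es] := P_repr u.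
apply: (weight_sum (f := fun x : C * word => x.1 *: mkP (vact x.2))
  (wt := fun x => lam + wdeg x.2)) es => x k.
apply: val_inj; rewrite !KPE !sub_valZ P_vact.
rewrite -/(Kh K k (x.1 *: vact x.2)) (linZ _ _ (linKh k)).
by rewrite vact_wt !scalerA mulrC.
Qed.

(** A nonzero submodule contains a nonzero weight vector [z *: act p0 v0]; the word [r] brings it
    back to a multiple of [v0], which generates [P]. *)
Lemma P_gsimple : gsimple GP KP.
Proof.
split.
  exists (mkP (vact [::])) => /(congr1 val); rewrite P_vact raddf0.
  exact: v0_neq0.
move=> S sS _ KS; have [[u Su nu]|nS] := pselect (exists2 u, S u & u <> 0); last first.
  by left=> u Su; apply: contrapT => nu; apply: nS; exists u.
right; pose S' v := exists2 u, S u & val u = v.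
have sS' : subspace S' by apply: sub_image_subspace.
have KS' g v : S' v -> S' (K g v).
  by move=> [z Sz <-]; exists (KP g z); [exact: KS | rewrite KPE].
have aS' p v : S' v -> S' (act p v) by elim: p => //= g p IH hv; apply/KS'/IH.
have [s es] := P_repr u.
have hs : S' (lcomb vact s) by exists u.
have [d nd] : exists d, lcomb vact [seq x <- s | wdeg x.2 == d] <> 0.
  apply: contrapT => /forallNP hn; apply: nu; apply: val_inj; rewrite es raddf0.
  by apply: (lcomb_partition (t := @wdeg m n)) => d; apply: contrapT; apply: hn.
have hd : S' (lcomb vact [seq x <- s | wdeg x.2 == d]).
  have := @component _ _ _ _ _ HK _ vact (fun p => lam + wdeg p) vact_wt
    _ s (lam + d) sS' _ hs.
  rewrite (eq_filter (a2 := fun x => wdeg x.2 == d)); last first.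
    by move=> x; rewrite (inj_eq (addrI _)).
  by apply=> k v hv; apply/KS'/KS'.
have S0 : S' v0.
  have [h|[p0 [r [c [e [nc hr he]]]]]] := degree_rep d.
    by case: nd; rewrite /lcomb big_filter big1 // => x /eqP ex; rewrite /vact h // scaler0.
  move: nd hd; rewrite (P_rep _ v0_lam he); set z := \sum_(_ <- _ | _) _ => nz hz.
  have nz0 : z != 0 by apply/eqP => z0; apply: nz; rewrite z0 scale0r.
  have := aS' r _ hz; rewrite (linZ _ _ (act_lin r)) hr // => hv.
  case: (sS') => _ [_ sZ]; have := sZ (c^-1 * z^-1) _ hv.
  rewrite !scalerA [Y in Y *: _](_ : _ = 1) ?scale1r //; field.
  by rewrite nc nz0.
move=> u'; have [t et] := P_repr u'.
have [z Sz ez] : S' (val u').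
  by rewrite et; apply: lcomb_in => // p; apply: aS'.
by rewrite -(val_inj ez).
Qed.

Lemma M_glmodule : glmodule GM EM.
Proof.
split; first exact: (sub_grading gG _ false (@wspace_gstable lam)).
split; first by move=> a c; apply: sub_op_lin => [|v]; [exact: gl_lin|exact: M_E].
split; first by move=> a c b u hu; rewrite /GM EME addbAC; apply: gl_par.
move=> a b c d w; apply: val_inj.
rewrite /scomm !sub_valB !EME gl_EE addrC addKr.
by congr (_ - _ *: _); case: eqP; rewrite ?EME ?raddf0.
Qed.

Lemma EM_weight (ka : idx -> C) y a b : wspace (glh E) ka y ->
  wspace (glh E) (fun k => ka k + (k == a)%:R - (k == b)%:R) (E a b y).
Proof.
move=> hy k; rewrite /glh gl_EE /glpar addbb sgF !scale1r.
have -> : E k k y = ka k *: y by apply: hy.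
rewrite (linZ _ _ (gl_lin a b)) [b == k]eq_sym.
by case: eqP => [->|_]; case: eqP => [->|_] /=; lmod.
Qed.

(** The joint eigenvectors of the [E k k] inside the weight space span a graded gl-submodule
    containing [v0], so [M_simple] applies. *)
Lemma M_weight : weight_mod (glh EM).
Proof.
pose T := {x : (idx -> C) * V | inM x.2 /\ wspace (glh E) x.1 x.2}.
pose f (i : T) := (sval i).2.
have inT ka y : inM y -> wspace (glh E) ka y -> exists s, y = lcomb f s.
  move=> hy hk; pose i : T := exist _ (ka, y) (conj hy hk).
  by exists [:: (1, i)]; rewrite lcomb1.
have sT := lcomb_subspace f.
have full : forall y, inM y -> exists s, y = lcomb f s.
  apply: M_simple => //.
  - apply: span_gstable => // -[[ka y] [/= hy hk]].
    have gk : gstable G (wspace (glh E) ka).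
      apply: gstable_forall => // k; apply: eigen_gstable => //; first exact: gl_lin.
      by rewrite -(addbb (ipar k)); exact: gl_par.
    have [u [w [[hu hu'] [[hw hw'] [Gu [Gw e]]]]]] :=
      gstable_and gG (@wspace_gstable lam) gk (conj hy hk).
    by exists u, w; split; [exact: inT hu hu'|split; [exact: inT hw hw'|]].
  - move=> _ [s ->]; apply: lcomb_in; first exact: sM.
    by move=> -[[ka y] [hy hk]].
  - move=> a b _ [s ->]; rewrite (map_lcomb _ _ (gl_lin a b)).
    apply: (@lcomb_in _ _ _ (fun y => exists s, y = lcomb f s)) => //.
    move=> -[[ka y] [/= hy hk]]; have hM : inM (E a b y) by apply: M_E.
    exact: inT hM (EM_weight a b hk).
  - by exists v0 => //; apply: inT v0_kap.
move=> w; have [s es] := full _ (sub_valP w).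
apply: (weight_sum (s := s) (f := fun x : C * T => x.1 *: mkM (f x.2))
  (wt := fun x => (sval x.2).1)) => [[c [[ka y] [/= hy hk]]] k|].
  have /= e : val (mkM y) = y by rewrite sub_mkK.
  apply: val_inj; rewrite EME !sub_valZ /f /= e (linZ _ _ (gl_lin k k)).
  by rewrite -/(glh E k y) hk !scalerA mulrC.
apply: val_inj; rewrite -[in RHS]/(lcomb (fun i => mkM (f i)) s).
rewrite (map_lcomb _ _ (@sub_val_lin _ _ sM)) es; apply: eq_bigr => -[c [[ka y] h]] _.
by rewrite /f sub_mkK //; case: h.
Qed.

Lemma M_gsimple : gsimple GM (glops EM).
Proof.
split.
  exists (mkM v0) => /(congr1 val); rewrite (sub_mkK sM v0_lam) raddf0.
  exact: v0_neq0.
move=> S sS gS ES; have [[u Su nu]|nS] := pselect (exists2 u, S u & u <> 0); last first.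
  by left=> u Su; apply: contrapT => nu; apply: nS; exists u.
right; pose S' v := exists2 u, S u & val u = v.
have full : forall y, inM y -> S' y.
  apply: M_simple.
  - exact: sub_image_subspace.
  - move=> _ [w Sw <-]; have [w0 [w1 [S0 [S1 [G0 [G1 ->]]]]]] := gS w Sw.
    exists (val w0), (val w1); split; first by exists w0.
    by split; [exists w1|rewrite raddfD; split; [|split]; rewrite -1?[true]addbF -1?[false]addbF].
  - by move=> _ [w _ <-]; apply: (sub_valP w).
  - by move=> a c _ [w Sw <-]; exists (EM a c w); [exact: (ES (a, c))|rewrite EME].
  - by exists (val u); [exists u|move=> e; apply: nu; apply: val_inj; rewrite e raddf0].
by move=> w; have [z Sz ez] := full _ (sub_valP w); rewrite -(val_inj ez).
Qed.

(** Words of the wrong parity contribute a vector of both parities, hence 0. The remaining words all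
    give the same sign when an [E a c] passes them. *)
Lemma P_homog q (u : P) : GP q u -> exists s, val u = lcomb vact [seq x <- s | wpar x.2 == q].
Proof.
move=> hu; have [s es] := P_repr u; exists s.
have [sG _] := gG; have sumG b : G (b (+) q0) (lcomb vact [seq x <- s | wpar x.2 == b]).
  rewrite /lcomb big_filter; apply: subspace_sum => // x /eqP <-.
  by case: (sG (wpar x.2 (+) q0)) => _ [_]; apply; apply: vact_par.
have e : val u - lcomb vact [seq x <- s | wpar x.2 == q] =
         lcomb vact [seq x <- s | wpar x.2 == ~~ q].
  apply/eqP; rewrite subr_eq es /lcomb !big_filter.
  rewrite (bigID (fun x : C * word => wpar x.2 == q)) /= addrC; apply/eqP.
  by congr (_ + _); apply: eq_bigl => x; case: (wpar _); case: (q).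
apply/eqP; rewrite -subr_eq0; apply/eqP; apply: (grading_cap gG (b := q (+) q0)).
  by apply: subspaceB.
by rewrite e -addNb; apply: sumG.
Qed.

Lemma decomposition : exists (P : lmodType C) (GP : bool -> P -> Prop) (KP : Kgen -> P -> P)
     (M : lmodType C) (GM : bool -> M -> Prop) (EM : idx -> idx -> M -> M) (b : P -> M -> V),
  (Kmodule GP KP /\ weight_mod (Kh KP) /\ gsimple GP KP) /\
  (glmodule GM EM /\ weight_mod (glh EM) /\ gsimple GM (glops EM)) /\
  is_tensor b /\
  (forall q q' u w, GP q u -> GM q' w -> G (q (+) q') (b u w)) /\
  (forall g u w, b (KP g u) w = K g (b u w)) /\
  (forall a c q u w, GP q u -> E a c (b u w) = sg (glpar a c && q) *: b u (EM a c w)).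
Proof.
have [b b_eq] := b_exists.
exists P, GP, KP, M, GM, EM, b; split; [|split; [|split; [|split; [|split]]]].
- by split; [exact: P_Kmodule|split; [exact: P_weight|exact: P_gsimple]].
- by split; [exact: M_glmodule|split; [exact: M_weight|exact: M_gsimple]].
- exact: b_tensor.
- move=> q q' u w /P_homog [s es]; rewrite /GM addbF => hw; rewrite (b_eq u w _ es).
  have [sG _] := gG; rewrite /lcomb big_filter; apply: subspace_sum => // x /eqP ex.
  case: (sG (q (+) q')) => _ [_]; apply; rewrite addbC -ex.
  exact: (act_par HK).
- move=> g u w; have [s es] := P_repr u; rewrite (b_eq u w _ es) (map_lcomb _ _ (linK g)).
  rewrite (b_eq _ w [seq (x.1, g :: x.2) | x <- s]).
    by rewrite (lcomb_map _ (cons g)).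
  by rewrite KPE es (map_lcomb _ _ (linK g)) (lcomb_map _ (cons g)).
- move=> a c q u w /P_homog [s es].
  rewrite !(b_eq u _ _ es) (map_lcomb _ _ (gl_lin a c)) /lcomb !big_filter scaler_sumr.
  apply: eq_bigr => x /eqP ex; rewrite E_act ex EME; lmod.
Qed.

End Decomposition.

(** * From the decomposition of [V] to the tensor module F(P,M) *)

Lemma Kmono_morph (m n : nat) (P Q : lmodType C) (K : Kgen m n -> P -> P)
    (K' : Kgen m n -> Q -> Q) (f : P -> Q) :
  (forall g u, f (K g u) = K' g (f u)) -> forall x u, f (Kmono K x u) = Kmono K' x (f u).
Proof.
move=> hf x u; rewrite /Kmono.
have hit g k z : f (iter k (K g) z) = iter k (K' g) (f z).
  by elim: k => //= k IH; rewrite hf IH.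
elim: (enum 'I_m) => [|i s IH] /=; last by rewrite hit IH.
by elim: (enum x.2) => //= j s IH; rewrite hf IH.
Qed.

Theorem theorem3p9 (m n : nat) (mn_pos : (0 < m + n)%N)
    (V : lmodType C) (G : bool -> V -> Prop)
    (aA : mono m n -> V -> V) (aW : mono m n -> idx m n -> V -> V) :
  AWmodule G aA aW ->
  weight_mod (AWh aW) ->
  gsimple G (AWops aA aW) ->
  (exists w : idx m n -> C,
      (exists v : V, v <> 0 /\ wspace (AWh aW) w v) /\ fin_dim (wspace (AWh aW) w)) ->
  exists (P : lmodType C) (GP : bool -> P -> Prop) (K : Kgen m n -> P -> P)
         (M : lmodType C) (GM : bool -> M -> Prop) (E : idx m n -> idx m n -> M -> M)
         (b : P -> M -> V),
    (Kmodule GP K /\ weight_mod (Kh K) /\ gsimple GP K) /\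
    (glmodule GM E /\ weight_mod (glh E) /\ gsimple GM (glops E)) /\
    is_FPM G aA aW GP K GM E b.
Proof.
move=> HAW _ Vsimple [w [[v [nv hv]] fw]].
pose K := KV aA aW; pose E := Eop aA aW.
have HK : Kmodule G K := KV_Kmodule HAW.
have gG := AW_grading HAW.
have EK a b g u : E a b (K g u) = sg (glpar a b && ipar g.1) *: K g (E a b u).
  exact: (EK HAW).
have HE : glmodule G E.
  split=> //; split; first exact: (linE HAW).
  split; first exact: (parE HAW).
  by move=> a b c d u; rewrite /scomm /E (EE HAW) addrC addKr.
have hE k u : AWh aW k u = E k k u + Kh K k u := AWh_split aA aW k u.
have lh k : lin (AWh aW k).
  by move=> c u z; rewrite !hE /E (linE HAW) (linKh HK); lmod.
(* Hence the [Kh K k] preserve the finite-dimensional weight space. *)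
have hKh j k u : AWh aW j (Kh K k u) = Kh K k (AWh aW j u).
  rewrite !hE (linD _ _ (linKh HK k)) (Kh_comm HK); congr (_ + _).
  exact: (E_Kh HK EK).
have ph k : has_parity G (AWh aW k) false.
  have -> : AWh aW k = aW (mvar k) k by case: (k).
  rewrite -(addbb (ipar k)); have := parW HAW (mvar k) k.
  by rewrite dpar_mvar.
have sw : subspace (wspace (AWh aW) w).
  split; first by move=> k; rewrite (lin0 (lh k)) scaler0.
  split=> [u z hu hz k|c z hz k]; first by rewrite (linD _ _ (lh k)) hu hz scalerDr.
  by rewrite (linZ _ _ (lh k)) hz !scalerA mulrC.
have [||lam [v1 [hv1 nv1 lv1]]] := common_eigenvector (linKh HK) (Kh_comm HK) sw _ fw.
- by move=> k u hu j; rewrite hKh hu (linZ _ _ (linKh HK k)).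
- by exists v.
have [||q0 [v0 [[hv0 lv0] pv0 nv0]]] := gstable_homog
    (S := fun u => wspace (AWh aW) w u /\ wspace (Kh K) lam u) (G := G).
- apply: gstable_and => //; last exact: (wspace_gstable HK).
  by apply: gstable_forall => // k; apply: eigen_gstable.
- by exists v1.
(* The Cartan operator is [E k k + Kh K k], so the difference of eigenvalues belongs to [E k k]. *)
pose kap k := w k - lam k.
have kv0 : wspace (glh E) kap v0.
  move=> k; rewrite /kap scalerBl -hv0 -lv0 hE addrK.
  by [].
have Euv0 : Eu aA aW v0 = (\sum_k kap k) *: v0.
  by rewrite scaler_suml; apply: eq_bigr => k _; apply: kv0.
have WF := W_formula HAW Vsimple nv0 Euv0.
(* By [WF] the action of W is built from monomials, the [D k] and the [E a b], so stability under
   [K] and [E] gives a submodule. *)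
have KEs (S : V -> Prop) : subspace S -> gstable G S ->
    (forall g u, S u -> S (K g u)) -> (forall a b u, S u -> S (E a b u)) ->
    (exists2 u, S u & u <> 0) -> forall u, S u.
  move=> sS gS SK SE; case: (sS) => _ [sD sZ].
  have SA x u : S u -> S (aA x u).
    move=> Su; rewrite -(KmonoE HAW) /Kmono.
    elim: (enum 'I_m) => [|i s IH] /=; last by elim: (x.1 i) => //= k; apply: (SK (inl i, false)).
    by elim: (enum x.2) => //= j s; apply: (SK (inr j, false)).
  apply: (AW_simple Vsimple) => // x l u Su.
  rewrite WF; apply: sD; first by apply: SA; apply: (SK (l, true)).
  by apply: subspace_sum => // k _; apply/sZ/SA/SE.
have lv0' : wspace (Kh K) [ffun k => lam k] v0 by move=> k; rewrite ffunE.
have [P [GP [KP [M [GM [EM [b [HP [HM [bt [bp [bK bE]]]]]]]]]]]] :=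
  decomposition HK HE EK KEs nv0 pv0 lv0' kv0.
exists P, GP, KP, M, GM, EM, b; do 2!split=> //; do 2!split=> //.
have bA x u y : aA x (b u y) = b (Kmono KP x u) y.
  rewrite -(KmonoE HAW); symmetry.
  by apply: (Kmono_morph (f := fun z => b z y)).
split=> // x l q u y hu.
rewrite WF -[aW _ l (b u y)]/(K (l, true) (b u y)) -bK bA big_sumType addrA.
have wE k : aA (mono_der k x).2 (E k l (b u y)) =
    sg (q && glpar k l) *: b (Kmono KP (mono_der k x).2 u) (EM k l y).
  by rewrite (bE _ _ q) // (linZ _ _ (linA HAW _)) bA andbC.
(* The sign [fsg] is 1 for even [k] and the prefactor of the odd sum for odd [k]; the remaining sign
   comes from moving [E k l] past [u]. *)
congr (_ + _ + _); last rewrite scaler_sumr; apply: eq_bigr => k _.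
- by rewrite wE scalerA /fsg sgF mul1r.
- by rewrite wE !scalerA /fsg -mulrA.
Qed.
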